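(* Let $k\ge1$, $\beta\in(0,1)$, $0<\varphi_{\text{out}}\le 1/30$, $0<\eta\le1/2$, and $t\ge1$. Let $G=(V_G,E_G)$ be a $(k,\varphi_{\text{out}},\beta)$-unclusterable graph with minimum degree at least $1$ and $\mathrm{vol}(V_G)$ sufficiently large in terms of $k,\beta,\eta$. Let $s=\frac{1600(k+1)^2\ln(12(k+1))\ln(\mathrm{vol}(V_G))}{\beta(1-\eta)}$ and let $S$ be a multiset of $s$ independent samples from a distribution $\mathcal{P}$ on $V_G$ with $|\mathcal{P}(v)-\deg(v)/\mathrm{vol}(V_G)|\le\eta\deg(v)/\mathrm{vol}(V_G)$ for all $v$. Then with probability at least $2/3$, $$\mu_{k+1}\big((D^{-1/2}M^tS)^\top(D^{-1/2}M^tS)\big)\ge\frac{8(k+1)\ln(12(k+1))}{\beta(1-\eta)\,\mathrm{vol}(V_G)}\,(1-30\varphi_{\text{out}})^{2t}.$$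
   Context: $G$ has adjacency matrix $A$ and diagonal degree matrix $D$; $\mathrm{vol}(S)=\sum_{v\in S}\deg(v)$; $\phi^G_{V_G}(C)=|E(C,V_G\setminus C)|/\mathrm{vol}(C)$. $G$ is $(k,\varphi,\beta)$-unclusterable if $V_G$ contains $k+1$ pairwise disjoint subsets $C_1,\dots,C_{k+1}$ with $\mathrm{vol}(C_i)\ge\beta\,\mathrm{vol}(V_G)/(k+1)$ and $\phi^G_{V_G}(C_i)\le\varphi$. $M=(I+AD^{-1})/2$ is the lazy random walk matrix. A multiset $S=\{a_1,\dots,a_s\}$ is identified with the $V_G\times s$ matrix with columns $\mathbb{1}_{a_i}$; $\mu_h(B)$ is the $h$-th largest eigenvalue of symmetric $B$. *)

(* Defs.v *)
From Stdlib Require Export Reals List Bool.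
Open Scope R_scope.

Fixpoint rsum (n : nat) (f : nat -> R) : R :=
  match n with O => 0 | S m => rsum m f + f m end.

(* Graph on vertex set V_G = {0,...,n-1}, given by a boolean adjacency relation. *)
Definition simple_graph (n : nat) (adj : nat -> nat -> bool) : Prop :=
  (forall u v, adj u v = adj v u) /\ (forall u, adj u u = false).

Definition adjm (adj : nat -> nat -> bool) (u v : nat) : R :=
  if adj u v then 1 else 0.

Definition deg (n : nat) (adj : nat -> nat -> bool) (v : nat) : R :=
  rsum n (fun u => adjm adj v u).

(* subsets of V_G as boolean predicates (only values on 0..n-1 matter) *)
Definition vol (n : nat) (adj : nat -> nat -> bool) (C : nat -> bool) : R :=
  rsum n (fun v => if C v then deg n adj v else 0).

Definition volV (n : nat) (adj : nat -> nat -> bool) : R := vol n adj (fun _ => true).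

Definition cut (n : nat) (adj : nat -> nat -> bool) (C : nat -> bool) : R :=
  rsum n (fun u => rsum n (fun v =>
    if andb (andb (C u) (negb (C v))) (adj u v) then 1 else 0)).

Definition conductance (n : nat) (adj : nat -> nat -> bool) (C : nat -> bool) : R :=
  cut n adj C / vol n adj C.

Definition unclusterable (n : nat) (adj : nat -> nat -> bool)
    (k : nat) (phi beta : R) : Prop :=
  exists C : nat -> nat -> bool,
    (forall i j v, (i < k + 1)%nat -> (j < k + 1)%nat -> i <> j -> (v < n)%nat ->
        ~ (C i v = true /\ C j v = true)) /\
    (forall i, (i < k + 1)%nat ->
        beta * volV n adj / INR (k + 1) <= vol n adj (C i) /\
        conductance n adj (C i) <= phi).

Definition matmul (n : nat) (X Y : nat -> nat -> R) (u v : nat) : R :=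
  rsum n (fun w => X u w * Y w v).

Definition idm (u v : nat) : R := if Nat.eqb u v then 1 else 0.

Fixpoint mpow (n : nat) (X : nat -> nat -> R) (t : nat) : nat -> nat -> R :=
  match t with O => idm | S t' => matmul n X (mpow n X t') end.

Definition lazyM (n : nat) (adj : nat -> nat -> bool) (u v : nat) : R :=
  (idm u v + adjm adj u v / deg n adj v) / 2.

(* the n x s matrix D^{-1/2} M^t S, for the sample a = [a_1; ...; a_s] *)
Definition embed (n : nat) (adj : nat -> nat -> bool) (t : nat) (a : list nat)
    (v j : nat) : R :=
  / sqrt (deg n adj v) * mpow n (lazyM n adj) t v (nth j a O).

Definition gram (n : nat) (adj : nat -> nat -> bool) (t : nat) (a : list nat)
    (i j : nat) : R :=
  rsum n (fun v => embed n adj t a v i * embed n adj t a v j).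

(* mu 0 >= mu 1 >= ... >= mu (m-1) is the list of eigenvalues (with multiplicity)
   of the symmetric m x m matrix B: there is an orthonormal basis w 0, ..., w (m-1)
   of R^m with B w i = mu i w i.  Then mu (h-1) is mu_h(B). *)
Definition is_spectrum (m : nat) (B : nat -> nat -> R) (mu : nat -> R) : Prop :=
  (forall i j, (i <= j)%nat -> (j < m)%nat -> mu j <= mu i) /\
  exists w : nat -> nat -> R,
    (forall i j, (i < m)%nat -> (j < m)%nat ->
        rsum m (fun l => w i l * w j l) = if Nat.eqb i j then 1 else 0) /\
    (forall i r, (i < m)%nat -> (r < m)%nat ->
        rsum m (fun l => B r l * w i l) = mu i * w i r).

Fixpoint tuples (n s : nat) : list (list nat) :=
  match s with
  | O => nil :: nil
  | S s' => flat_map (fun v => map (cons v) (tuples n s')) (seq 0 n)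
  end.

Definition weight (P : nat -> R) (a : list nat) : R :=
  fold_right (fun v acc => P v * acc) 1 a.

Definition prob (n s : nat) (P : nat -> R) (Good : list nat -> bool) : R :=
  fold_right (fun a acc => (if Good a then weight P a else 0) + acc) 0 (tuples n s).

Definition approx_deg_dist (n : nat) (adj : nat -> nat -> bool) (eta : R)
    (P : nat -> R) : Prop :=
  (forall v, (v < n)%nat -> 0 <= P v) /\ rsum n P = 1 /\
  (forall v, (v < n)%nat ->
     Rabs (P v - deg n adj v / volV n adj) <= eta * deg n adj v / volV n adj).

Definition sample_size (n : nat) (adj : nat -> nat -> bool) (k : nat) (beta eta : R) : R :=
  1600 * INR (k + 1) ^ 2 * ln (12 * INR (k + 1)) * ln (volV n adj)
    / (beta * (1 - eta)).

(* Main.v *)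
(* Let [W] be the lazy walk acting on functions; it is self-adjoint with [0 <= W <= 1] for the
   degree-weighted inner product. Any combination [f] of the indicators of the [k + 1] clusters
   has [<f, (1 - W) f> <= phi <f, f>], so, with [nu = 1 - 30 phi], Tikhonov regularization yields
   [w] such that [g = W^t w] is close to [f] and [|w|^2] is at most about [nu^(-2t) |f|^2]; this
   takes the place of projecting [f] on the eigenvalues of [W] above [nu].

   The vector [z_j = g (a_j)] of samples satisfies [|z|^4 <= (z, Gram z) |w|^2], so by
   Courant-Fischer it suffices that [|z|^2] is large for all unit coefficient vectors of [f].
   As [f] is flat on the clusters and [g] is close to it in norm, [g] exceeds a constant threshold
   on a constant fraction of the volume, so each sample hits with constant probability. With
   order [ln vol] samples, having fewer than a constant number [H] of hits has probability a large
   negative power of [vol], which beats the union bound over a grid of [poly(vol)] coefficient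
   vectors. *)
Require Import Defs.
From Stdlib Require Import Reals List Lra Lia Arith ZArith.
Open Scope R_scope.

(** * Finite sums and linear algebra *)

Lemma rsum_ext n f g : (forall i, (i < n)%nat -> f i = g i) -> rsum n f = rsum n g.
Proof.
  induction n as [|n IH]; simpl; intros H; [reflexivity|].
  rewrite IH, (H n); auto.
Qed.

Lemma rsum_plus n f g : rsum n (fun i => f i + g i) = rsum n f + rsum n g.
Proof. induction n as [|n IH]; simpl; [ring|rewrite IH; ring]. Qed.

Lemma rsum_scal n c f : rsum n (fun i => c * f i) = c * rsum n f.
Proof. induction n as [|n IH]; simpl; [ring|rewrite IH; ring]. Qed.

Lemma rsum_minus n f g : rsum n (fun i => f i - g i) = rsum n f - rsum n g.
Proof. induction n as [|n IH]; simpl; [ring|rewrite IH; ring]. Qed.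

Lemma rsum_const n c : rsum n (fun _ => c) = INR n * c.
Proof. induction n as [|n IH]; [simpl; ring|rewrite S_INR; simpl; rewrite IH; ring]. Qed.

Lemma rsum_zero n f : (forall i, (i < n)%nat -> f i = 0) -> rsum n f = 0.
Proof. intros H. rewrite (rsum_ext n f (fun _ => 0) H), rsum_const. ring. Qed.

Lemma rsum_le n f g : (forall i, (i < n)%nat -> f i <= g i) -> rsum n f <= rsum n g.
Proof.
  induction n as [|n IH]; simpl; intros H; [lra|].
  apply Rplus_le_compat; auto.
Qed.

Lemma rsum_nonneg n f : (forall i, (i < n)%nat -> 0 <= f i) -> 0 <= rsum n f.
Proof. intros H. rewrite <- (rsum_zero n (fun _ => 0)) by auto. now apply rsum_le. Qed.

Lemma rsum_term_le n f i :
  (forall j, (j < n)%nat -> 0 <= f j) -> (i < n)%nat -> f i <= rsum n f.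
Proof.
  induction n as [|n IH]; intros H Hi; [lia|simpl].
  destruct (Nat.eq_dec i n) as [->|Hn].
  - assert (0 <= rsum n f) by (apply rsum_nonneg; auto). lra.
  - assert (f i <= rsum n f) by (apply IH; [auto|lia]).
    assert (0 <= f n) by auto. lra.
Qed.

Lemma rsum_swap n m (f : nat -> nat -> R) :
  rsum n (fun i => rsum m (f i)) = rsum m (fun j => rsum n (fun i => f i j)).
Proof.
  induction n as [|n IH]; simpl.
  - now rewrite rsum_zero.
  - rewrite IH. symmetry. apply rsum_plus.
Qed.

Lemma rsum_shift n f : rsum (S n) f = f O + rsum n (fun i => f (S i)).
Proof.
  induction n as [|n IH]; [simpl; ring|].
  change (rsum (S (S n)) f) with (rsum (S n) f + f (S n)).
  rewrite IH. simpl. ring.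
Qed.

Lemma rsum_single n f i :
  (i < n)%nat -> (forall j, (j < n)%nat -> j <> i -> f j = 0) -> rsum n f = f i.
Proof.
  induction n as [|n IH]; intros Hi H; [lia|simpl].
  destruct (Nat.eq_dec i n) as [->|Hn].
  - rewrite rsum_zero; [ring|]. intros j Hj. apply H; lia.
  - rewrite IH, (H n); [ring|lia|lia|lia|]. intros; apply H; lia.
Qed.

Lemma rsum_mult n m f g :
  rsum n f * rsum m g = rsum n (fun i => rsum m (fun j => f i * g j)).
Proof.
  rewrite Rmult_comm, <- rsum_scal. apply rsum_ext; intros.
  rewrite rsum_scal. ring.
Qed.

(** The quadratic is evaluated at its minimizer [b / c]; if [c = 0] it is affine, and a nonzero
    slope would let it reach -1. *)
Lemma quadratic_nonneg_discr a b c :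
  0 <= c -> (forall x, 0 <= a - 2 * x * b + x * x * c) -> b * b <= a * c.
Proof.
  intros Hc H.
  destruct (Req_dec c 0) as [->|Hc0].
  - destruct (Req_dec b 0) as [->|Hb]; [lra|].
    specialize (H ((a + 1) / (2 * b))).
    replace (2 * ((a + 1) / (2 * b)) * b) with (a + 1) in H by (field; auto). lra.
  - specialize (H (b / c)).
    replace (a - 2 * (b / c) * b + b / c * (b / c) * c) with ((a * c - b * b) / c) in H
      by (field; auto).
    assert (0 <= (a * c - b * b) / c * c) by nra.
    replace ((a * c - b * b) / c * c) with (a * c - b * b) in H0 by (field; auto). lra.
Qed.

Lemma rsum_cauchy_schwarz n f g :
  rsum n (fun i => f i * g i) * rsum n (fun i => f i * g i)
  <= rsum n (fun i => f i * f i) * rsum n (fun i => g i * g i).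
Proof.
  apply quadratic_nonneg_discr.
  - apply rsum_nonneg; intros; apply Rle_0_sqr.
  - intros x.
    replace (_ - _ + _) with (rsum n (fun i => (f i - x * g i) * (f i - x * g i))).
    + apply rsum_nonneg; intros; apply Rle_0_sqr.
    + rewrite <- !rsum_scal, <- rsum_minus, <- rsum_plus.
      apply rsum_ext; intros; ring.
Qed.

Lemma rsum_sq_disjoint n f :
  (forall i j, (i < n)%nat -> (j < n)%nat -> i <> j -> f i * f j = 0) ->
  rsum n f * rsum n f = rsum n (fun i => f i * f i).
Proof.
  intros H. rewrite rsum_mult. apply rsum_ext; intros i Hi.
  apply (rsum_single n (fun j => f i * f j)); auto.
Qed.

(** Gaussian elimination by induction on the number of equations: a pivot in the last column
    eliminates the last unknown; if that column vanishes, the last unit vector is a solution. *)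
Lemma underdetermined_kernel k (A : nat -> nat -> R) :
  exists x : nat -> R,
    (exists i, (i < S k)%nat /\ x i <> 0) /\
    forall r, (r < k)%nat -> rsum (S k) (fun i => A r i * x i) = 0.
Proof.
  revert A. induction k as [|k IH]; intros A.
  - exists (fun _ => 1). split; [exists O; split; [lia|lra]|lia].
  - assert (Hpivot : (exists p, (p < S k)%nat /\ A p (S k) <> 0) \/
                     forall r, (r < S k)%nat -> A r (S k) = 0).
    (* Only the number of rows searched is generalized; the column index [S k] stays fixed. *)
    { clear. induction (S k) as [|m IHm] at 1 3; [right; lia|].
      destruct IHm as [[p [Hp HA]]|IHm]; [left; exists p; split; [lia|auto]|].
      destruct (Req_dec (A m (S k)) 0) as [E|E].
      - right; intros r Hr. destruct (Nat.eq_dec r m) as [->|]; [auto|apply IHm; lia].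
      - left; exists m; split; [lia|auto]. }
    destruct Hpivot as [[p [Hp HA]]|Hzero].
    (* [row] enumerates the rows other than the pivot [p]: row [k] takes the place of [p]. *)
    + set (row r := if Nat.eqb r p then k else r).
      destruct (IH (fun r i => A (row r) i - A (row r) (S k) / A p (S k) * A p i))
        as [x [[i0 [Hi0 Hx0]] Hx]].
      set (last := - rsum (S k) (fun i => A p i * x i) / A p (S k)).
      set (y := fun i => if Nat.eqb i (S k) then last else x i).
      assert (Hsum : forall B, rsum (S (S k)) (fun i => B i * y i)
                     = rsum (S k) (fun i => B i * x i) + B (S k) * last).
      { intros B. change (rsum (S (S k)) ?f) with (rsum (S k) f + f (S k)).
        unfold y at 2. rewrite Nat.eqb_refl. f_equal.
        apply rsum_ext; intros i Hi. unfold y.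
        destruct (Nat.eqb_spec i (S k)); [lia|reflexivity]. }
      exists y. split.
      * exists i0. split; [lia|]. unfold y.
        destruct (Nat.eqb_spec i0 (S k)); [lia|auto].
      * intros r Hr. rewrite Hsum.
        destruct (Nat.eq_dec r p) as [->|Hrp].
        -- unfold last. field; auto.
        -- assert (Hr' : exists r', (r' < k)%nat /\ row r' = r).
           { unfold row. destruct (Nat.eq_dec r k) as [->|Hrk].
             - exists p. rewrite Nat.eqb_refl. split; [lia|auto].
             - exists r. destruct (Nat.eqb_spec r p); [lia|split; [lia|auto]]. }
           destruct Hr' as [r' [Hr' <-]].
           specialize (Hx r' Hr'). unfold last.
           rewrite (rsum_ext _ _ (fun i => A (row r') i * x i
                - A (row r') (S k) / A p (S k) * (A p i * x i))) in Hx by (intros; ring).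
           rewrite rsum_minus, rsum_scal in Hx.
           rewrite <- Hx. field; auto.
    + exists (fun i => if Nat.eqb i (S k) then 1 else 0). split.
      * exists (S k). rewrite Nat.eqb_refl. split; [lia|lra].
      * intros r Hr. apply rsum_zero; intros i Hi.
        destruct (Nat.eqb_spec i (S k)) as [->|]; [rewrite Hzero by auto|]; ring.
Qed.

(** By injectivity, a kernel vector of [B] augmented by the column [b] has a nonzero last entry;
    dividing by its negative gives the solution. *)
Lemma injective_solvable n (B : nat -> nat -> R) (b : nat -> R) :
  (forall x, (forall r, (r < n)%nat -> rsum n (fun i => B r i * x i) = 0) ->
     forall i, (i < n)%nat -> x i = 0) ->
  exists x, forall r, (r < n)%nat -> rsum n (fun i => B r i * x i) = b r.
Proof.
  intros Hinj.
  destruct (underdetermined_kernel n (fun r i => if Nat.eqb i n then b r else B r i))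
    as [x [[i [Hi Hxi]] Hx]].
  assert (Hx' : forall r, (r < n)%nat -> rsum n (fun i => B r i * x i) + b r * x n = 0).
  { intros r Hr. rewrite <- (Hx r Hr). simpl. rewrite Nat.eqb_refl. f_equal.
    apply rsum_ext; intros j Hj. destruct (Nat.eqb_spec j n); [lia|reflexivity]. }
  destruct (Req_dec (x n) 0) as [E|E].
  - exfalso. apply Hxi. destruct (Nat.eq_dec i n) as [->|]; [auto|].
    apply Hinj; [|lia]. intros r Hr. rewrite <- (Hx' r Hr), E. ring.
  - exists (fun i => - / x n * x i). intros r Hr.
    rewrite (rsum_ext _ _ (fun i => - / x n * (B r i * x i))) by (intros; ring).
    rewrite rsum_scal.
    replace (rsum n (fun i => B r i * x i)) with (- (b r * x n)) by (specialize (Hx' r Hr); lra).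
    field; auto.
Qed.

(** Orthonormality makes the map from coefficients to combinations injective, hence onto by
    [injective_solvable]; the coefficients are then read off as inner products. *)
Lemma orthonormal_expansion m (w : nat -> nat -> R) (z : nat -> R) :
  (forall i j, (i < m)%nat -> (j < m)%nat ->
     rsum m (fun l => w i l * w j l) = if Nat.eqb i j then 1 else 0) ->
  forall l, (l < m)%nat ->
    z l = rsum m (fun i => rsum m (fun r => z r * w i r) * w i l).
Proof.
  intros Hw.
  assert (Hcoef : forall c j, (j < m)%nat ->
            rsum m (fun l => rsum m (fun i => w i l * c i) * w j l) = c j).
  { intros c j Hj.
    rewrite (rsum_ext _ _ (fun l => rsum m (fun i => c i * (w i l * w j l)))).
    2:{ intros l Hl. rewrite Rmult_comm, <- rsum_scal. apply rsum_ext; intros; ring. }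
    rewrite rsum_swap.
    rewrite (rsum_single m _ j); auto.
    - rewrite rsum_scal, Hw, Nat.eqb_refl by auto. ring.
    - intros i Hi Hij. rewrite rsum_scal, Hw by auto.
      destruct (Nat.eqb_spec i j); [lia|ring]. }
  destruct (injective_solvable m (fun l i => w i l) z) as [c Hc].
  - intros x Hx j Hj. rewrite <- (Hcoef x j Hj).
    apply rsum_zero; intros l Hl. rewrite Hx by auto. ring.
  - intros l Hl. rewrite <- (Hc l Hl). apply rsum_ext; intros i Hi.
    rewrite <- (Hcoef c i Hi) at 1. rewrite Rmult_comm. f_equal.
    apply rsum_ext; intros r Hr. now rewrite Hc.
Qed.

(** * The lazy walk and its moments *)

Definition wip (n : nat) (d x y : nat -> R) : R := rsum n (fun v => d v * (x v * y v)).

(* The transpose of [lazyM] acting on functions; it is self-adjoint for the degree-weighted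
   inner product, which replaces the conjugation of [M] by [D^{1/2}]. *)
Definition walk (n : nat) (adj : nat -> nat -> bool) (x : nat -> R) (v : nat) : R :=
  rsum n (fun u => lazyM n adj u v * x u).

Definition walkn (n : nat) (adj : nat -> nat -> bool) (j : nat) (x : nat -> R) : nat -> R :=
  Nat.iter j (walk n adj) x.

Lemma wip_ext n d x y x' y' :
  (forall v, (v < n)%nat -> x v = x' v) -> (forall v, (v < n)%nat -> y v = y' v) ->
  wip n d x y = wip n d x' y'.
Proof. intros Hx Hy. apply rsum_ext; intros. now rewrite Hx, Hy. Qed.

Lemma wip_sym n d x y : wip n d x y = wip n d y x.
Proof. apply rsum_ext; intros; ring. Qed.

Lemma wip_lin_r n d x y z a b :
  wip n d x (fun v => a * y v + b * z v) = a * wip n d x y + b * wip n d x z.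
Proof.
  unfold wip. rewrite <- !rsum_scal, <- rsum_plus. apply rsum_ext; intros; ring.
Qed.

Lemma wip_lin_l n d x y z a b :
  wip n d (fun v => a * y v + b * z v) x = a * wip n d y x + b * wip n d z x.
Proof. rewrite wip_sym, wip_lin_r. now rewrite !(wip_sym n d x). Qed.

Lemma wip_nonneg n d x : (forall v, (v < n)%nat -> 0 <= d v) -> 0 <= wip n d x x.
Proof.
  intros Hd. apply rsum_nonneg; intros v Hv. apply Rmult_le_pos; [auto|apply Rle_0_sqr].
Qed.

Lemma walk_ext n adj x y v :
  (forall u, (u < n)%nat -> x u = y u) -> walk n adj x v = walk n adj y v.
Proof. intros H. apply rsum_ext; intros. now rewrite H. Qed.

Lemma walkn_sum n adj j q (c : nat -> R) (x : nat -> nat -> R) v :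
  walkn n adj j (fun u => rsum q (fun i => c i * x i u)) v
  = rsum q (fun i => c i * walkn n adj j (x i) v).
Proof.
  revert v; induction j as [|j IH]; intros v; [reflexivity|].
  simpl. rewrite (walk_ext _ _ _ (fun u => rsum q (fun i => c i * walkn n adj j (x i) u)))
    by (intros; apply IH).
  unfold walk.
  rewrite (rsum_ext n _ (fun u => rsum q (fun i => c i * (lazyM n adj u v * walkn n adj j (x i) u)))).
  - rewrite rsum_swap. apply rsum_ext; intros. apply rsum_scal.
  - intros. rewrite <- rsum_scal. apply rsum_ext; intros; ring.
Qed.

Lemma walkn_lin n adj j a b x y v :
  walkn n adj j (fun u => a * x u + b * y u) v
  = a * walkn n adj j x v + b * walkn n adj j y v.
Proof.
  revert v; induction j as [|j IH]; intros v; [reflexivity|].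
  simpl. rewrite (walk_ext _ _ _ _ v (fun u _ => IH u)).
  unfold walk. rewrite <- !rsum_scal, <- rsum_plus. apply rsum_ext; intros; ring.
Qed.

Lemma walkn_add n adj i j x : walkn n adj i (walkn n adj j x) = walkn n adj (i + j) x.
Proof. unfold walkn. now rewrite Nat.iter_add. Qed.

(** Turns the columns of [M^t] in the embedding into the iterated walk on functions: pairing the
    column of a sample with [x] evaluates [W^t x] at that sample. *)
Lemma walkn_mpow n adj t x a :
  (a < n)%nat ->
  rsum n (fun v => mpow n (lazyM n adj) t v a * x v) = walkn n adj t x a.
Proof.
  intros Ha. revert x; induction t as [|t IH]; intros x.
  - simpl. rewrite (rsum_single n _ a); auto.
    + unfold idm. rewrite Nat.eqb_refl. ring.
    + intros j _ Hj. unfold idm. destruct (Nat.eqb_spec j a); [lia|ring].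
  (* [mpow] multiplies on the left, so after transposition the additional step of the walk is the
     one applied to [x] first. *)
  - unfold walkn. rewrite Nat.iter_succ_r. fold (walkn n adj t (walk n adj x)).
    rewrite <- IH. simpl. unfold matmul, walk.
    rewrite (rsum_ext n _ (fun v => rsum n (fun w =>
       mpow n (lazyM n adj) t w a * (lazyM n adj v w * x v)))).
    + rewrite rsum_swap. apply rsum_ext; intros. apply rsum_scal.
    + intros. rewrite Rmult_comm, <- rsum_scal. apply rsum_ext; intros; ring.
Qed.

(** * The quadratic form of the lazy walk *)

Lemma adjm_sym n adj u v : simple_graph n adj -> adjm adj u v = adjm adj v u.
Proof. intros [H _]. unfold adjm. now rewrite H. Qed.

(** The degree weight cancels the division by the degree in [lazyM], leaving a form in the adjacency
    matrix. *)
Lemma wip_walk n adj x y :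
  (forall v, (v < n)%nat -> 1 <= deg n adj v) ->
  wip n (deg n adj) x (walk n adj y)
  = / 2 * (wip n (deg n adj) x y
           + rsum n (fun u => rsum n (fun v => adjm adj u v * (x v * y u)))).
Proof.
  intros Hd. unfold wip. rewrite rsum_swap, <- rsum_plus, <- rsum_scal.
  apply rsum_ext; intros v Hv. unfold walk, lazyM.
  specialize (Hd v Hv).
  rewrite (rsum_ext n _ (fun u => / 2 * (idm u v * y u) + / 2 * / deg n adj v * (adjm adj u v * y u)))
    by (intros; field; lra).
  rewrite rsum_plus, !rsum_scal.
  rewrite (rsum_single n (fun u => idm u v * y u) v); auto.
  2:{ intros j _ Hj. unfold idm. destruct (Nat.eqb_spec j v); [lia|ring]. }
  rewrite (rsum_ext n (fun i => adjm adj i v * (x v * y i)) (fun i => x v * (adjm adj i v * y i)))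
    by (intros; ring).
  rewrite rsum_scal. unfold idm. rewrite Nat.eqb_refl. field. lra.
Qed.

Lemma wip_walk_sym n adj x y :
  simple_graph n adj -> (forall v, (v < n)%nat -> 1 <= deg n adj v) ->
  wip n (deg n adj) (walk n adj x) y = wip n (deg n adj) x (walk n adj y).
Proof.
  intros Hg Hd. rewrite wip_sym, !wip_walk, (wip_sym n _ y x) by auto.
  do 2 f_equal. rewrite rsum_swap. apply rsum_ext; intros; apply rsum_ext; intros.
  rewrite (adjm_sym n) by auto. ring.
Qed.

(** The sign [s] treats sums and differences along edges at once: [s = 1] yields positivity of the
    walk, [s = -1] its Dirichlet form. *)
Lemma rsum_edges_sq n adj x s :
  simple_graph n adj -> s * s = 1 ->
  rsum n (fun u => rsum n (fun v => adjm adj u v * ((x u + s * x v) * (x u + s * x v))))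
  = 2 * wip n (deg n adj) x x
    + 2 * s * rsum n (fun u => rsum n (fun v => adjm adj u v * (x v * x u))).
Proof.
  intros Hg Hs.
  assert (E1 : rsum n (fun u => rsum n (fun v => adjm adj u v * (x u * x u)))
               = wip n (deg n adj) x x).
  { apply rsum_ext; intros u _. unfold deg. rewrite (Rmult_comm (rsum _ _)), <- rsum_scal.
    apply rsum_ext; intros; ring. }
  assert (E2 : rsum n (fun u => rsum n (fun v => adjm adj u v * (x v * x v)))
               = wip n (deg n adj) x x).
  { rewrite <- E1, rsum_swap. apply rsum_ext; intros; apply rsum_ext; intros.
    now rewrite (adjm_sym n). }
  transitivity (rsum n (fun u => rsum n (fun v => adjm adj u v * (x u * x u)))
    + rsum n (fun u => rsum n (fun v => adjm adj u v * (x v * x v)))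
    + 2 * s * rsum n (fun u => rsum n (fun v => adjm adj u v * (x v * x u)))).
  - rewrite <- rsum_scal, <- !rsum_plus. apply rsum_ext; intros u _.
    rewrite <- rsum_scal, <- !rsum_plus. apply rsum_ext; intros v _.
    replace (_ * (_ * _)) with (adjm adj u v * (x u * x u) + (s * s) * (adjm adj u v * (x v * x v))
      + 2 * s * (adjm adj u v * (x v * x u))) by ring.
    rewrite Hs. ring.
  - rewrite E1, E2. ring.
Qed.

(** Thanks to laziness the form is 1/4 of the sum of [(x u + x v)^2] over ordered adjacent pairs. *)
Lemma wip_walk_nonneg n adj x :
  simple_graph n adj -> (forall v, (v < n)%nat -> 1 <= deg n adj v) ->
  0 <= wip n (deg n adj) x (walk n adj x).
Proof.
  intros Hg Hd. rewrite wip_walk by auto.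
  assert (H := rsum_edges_sq n adj x 1 Hg ltac:(ring)).
  enough (0 <= rsum n (fun u => rsum n (fun v => adjm adj u v * ((x u + 1 * x v) * (x u + 1 * x v))))) by lra.
  do 2 (apply rsum_nonneg; intros). apply Rmult_le_pos; [unfold adjm; destruct adj; lra|apply Rle_0_sqr].
Qed.

(** In the factor 1/4, one 1/2 comes from laziness and the other from counting each edge in both
    orientations. *)
Lemma wip_walk_dirichlet n adj x :
  simple_graph n adj -> (forall v, (v < n)%nat -> 1 <= deg n adj v) ->
  wip n (deg n adj) x x - wip n (deg n adj) x (walk n adj x)
  = / 4 * rsum n (fun u => rsum n (fun v => adjm adj u v * ((x u - x v) * (x u - x v)))).
Proof.
  intros Hg Hd. rewrite wip_walk by auto.
  assert (H := rsum_edges_sq n adj x (-1) Hg ltac:(ring)).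
  rewrite (rsum_ext n _ (fun u => rsum n (fun v => adjm adj u v * ((x u - x v) * (x u - x v))))) in H.
  - lra.
  - intros; apply rsum_ext; intros; ring.
Qed.

Lemma wip_walk_le n adj x :
  simple_graph n adj -> (forall v, (v < n)%nat -> 1 <= deg n adj v) ->
  wip n (deg n adj) x (walk n adj x) <= wip n (deg n adj) x x.
Proof.
  intros Hg Hd. assert (H := wip_walk_dirichlet n adj x Hg Hd).
  enough (0 <= rsum n (fun u => rsum n (fun v => adjm adj u v * ((x u - x v) * (x u - x v))))) by lra.
  do 2 (apply rsum_nonneg; intros). apply Rmult_le_pos; [unfold adjm; destruct adj; lra|apply Rle_0_sqr].
Qed.

(** * Moments of the walk and Tikhonov regularization *)

Lemma wip_walkn n adj i j x y :
  simple_graph n adj -> (forall v, (v < n)%nat -> 1 <= deg n adj v) ->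
  wip n (deg n adj) (walkn n adj i x) (walkn n adj j y)
  = wip n (deg n adj) x (walkn n adj (i + j) y).
Proof.
  intros Hg Hd. revert j; induction i as [|i IH]; intros j; [reflexivity|].
  simpl (walkn n adj (S i) x). change (walkn n adj (S i) x) with (walk n adj (walkn n adj i x)).
  rewrite wip_walk_sym by auto.
  change (walk n adj (walkn n adj j y)) with (walkn n adj (S j) y).
  rewrite IH. do 2 f_equal. lia.
Qed.

Lemma deg_nonneg n adj v : 0 <= deg n adj v.
Proof. apply rsum_nonneg; intros. unfold adjm; destruct adj; lra. Qed.

(** Self-adjointness splits [W^j] evenly: an even moment is the squared norm of [W^i x], an odd one
    is the form of [W] at [W^i x]. *)
Lemma moment_nonneg n adj x j :
  simple_graph n adj -> (forall v, (v < n)%nat -> 1 <= deg n adj v) ->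
  0 <= wip n (deg n adj) x (walkn n adj j x).
Proof.
  intros Hg Hd. destruct (Nat.Even_or_Odd j) as [[i ->]|[i ->]].
  - replace (2 * i)%nat with (i + i)%nat by lia.
    rewrite <- wip_walkn by auto. apply wip_nonneg; intros; apply deg_nonneg.
  - replace (2 * i + 1)%nat with (i + S i)%nat by lia.
    rewrite <- wip_walkn by auto. apply wip_walk_nonneg; auto.
Qed.

Lemma moment_even_step_le n adj x j :
  simple_graph n adj -> (forall v, (v < n)%nat -> 1 <= deg n adj v) ->
  wip n (deg n adj) x (walkn n adj (S (2 * j)) x) <= wip n (deg n adj) x (walkn n adj (2 * j) x).
Proof.
  intros Hg Hd. replace (S (2 * j))%nat with (j + S j)%nat by lia.
  replace (2 * j)%nat with (j + j)%nat by lia.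
  rewrite <- !wip_walkn by auto. apply wip_walk_le; auto.
Qed.

(** The right-hand side is the [j]-th moment of [(nu - W) x]. *)
Lemma moment_quadratic n adj x j nu :
  simple_graph n adj -> (forall v, (v < n)%nat -> 1 <= deg n adj v) ->
  0 <= nu * nu * wip n (deg n adj) x (walkn n adj j x)
       - 2 * nu * wip n (deg n adj) x (walkn n adj (S j) x)
       + wip n (deg n adj) x (walkn n adj (S (S j)) x).
Proof.
  intros Hg Hd.
  assert (H := moment_nonneg n adj (fun v => nu * x v + (-1) * walkn n adj 1 x v) j Hg Hd).
  rewrite (wip_ext _ _ _ _ _ (fun v => nu * walkn n adj j x v + (-1) * walkn n adj j (walkn n adj 1 x) v)
    (fun v _ => eq_refl) (fun v _ => walkn_lin _ _ _ _ _ _ _ v)) in H.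
  rewrite walkn_add, wip_lin_r, !wip_lin_l, !wip_walkn in H by auto.
  replace (j + 1)%nat with (S j) in H by lia.
  replace (1 + j)%nat with (S j) in H by lia.
  replace (1 + S j)%nat with (S (S j)) in H by lia. lra.
Qed.

(* Jensen's inequality for the spectral measure of [x], read off the moments. *)
Lemma moment_ratio n adj x nu :
  simple_graph n adj -> (forall v, (v < n)%nat -> 1 <= deg n adj v) -> 0 <= nu ->
  nu * wip n (deg n adj) x x <= wip n (deg n adj) x (walk n adj x) ->
  forall i j, nu ^ j * wip n (deg n adj) x (walkn n adj i x)
    <= wip n (deg n adj) x (walkn n adj (j + i) x).
Proof.
  intros Hg Hd Hnu H0.
  (* With [m_j] for the moments, [nu m_j <= m_{j+1}] propagates: [m_{j+2} >= 2 nu m_{j+1} - nu (nu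
     m_j) >= nu m_{j+1}]. *)
  assert (Hs : forall j, nu * wip n (deg n adj) x (walkn n adj j x)
                 <= wip n (deg n adj) x (walkn n adj (S j) x)).
  { induction j as [|j IH]; [exact H0|].
    assert (Hq := moment_quadratic n adj x j nu Hg Hd). nra. }
  intros i; induction j as [|j IH]; simpl (nu ^ _); simpl (_ + _)%nat; [lra|].
  specialize (Hs (j + i)%nat). nra.
Qed.

(** The quadratic form of [1 + kap W^{2t}] dominates the squared norm, so this operator is injective
    and hence onto. *)
Lemma regularized_solution_exists n adj t kap f :
  simple_graph n adj -> (forall v, (v < n)%nat -> 1 <= deg n adj v) -> 0 <= kap ->
  exists y, forall v, (v < n)%nat -> y v + kap * walkn n adj (2 * t) y v = f v.
Proof.
  intros Hg Hd Hk.
  set (B r i := idm r i + kap * mpow n (lazyM n adj) (2 * t) i r).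
  assert (HB : forall x r, (r < n)%nat ->
            rsum n (fun i => B r i * x i) = x r + kap * walkn n adj (2 * t) x r).
  { intros x r Hr. rewrite <- walkn_mpow by auto. rewrite <- rsum_scal.
    unfold B. rewrite (rsum_ext n _ (fun i => idm r i * x i
      + kap * (mpow n (lazyM n adj) (2 * t) i r * x i))) by (intros; ring).
    rewrite rsum_plus. f_equal. rewrite (rsum_single n _ r); auto.
    - unfold idm. rewrite Nat.eqb_refl. ring.
    - intros j _ Hj. unfold idm. destruct (Nat.eqb_spec r j); [lia|ring]. }
  destruct (injective_solvable n B f) as [y Hy].
  - intros x Hx.
    assert (E : wip n (deg n adj) x (fun v => 1 * x v + kap * walkn n adj (2 * t) x v) = 0).
    { apply rsum_zero; intros v Hv. rewrite Rmult_1_l, <- HB, Hx by auto. ring. }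
    rewrite wip_lin_r in E.
    assert (H1 := moment_nonneg n adj x (2 * t) Hg Hd).
    assert (H2 : 0 <= wip n (deg n adj) x x) by (apply wip_nonneg; intros; apply deg_nonneg).
    intros i Hi.
    assert (H3 : deg n adj i * (x i * x i) <= wip n (deg n adj) x x).
    { apply (rsum_term_le n (fun v => deg n adj v * (x v * x v))); auto.
      intros; apply Rmult_le_pos; [apply deg_nonneg|apply Rle_0_sqr]. }
    specialize (Hd i Hi). nra.
  - exists y. intros v Hv. rewrite <- HB by auto. auto.
Qed.

(* With [phi] the Rayleigh quotient of [f], the residual [y] of Tikhonov regularization cannot
   carry more than 1/30 of the norm of [f]: otherwise its own Rayleigh quotient would be at most
   [30 * phi], so that [kap * W^{2t}] would amplify it by a factor 5. *)
Lemma regularized_solution_bounds n adj t phi f y nu kap :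
  simple_graph n adj -> (forall v, (v < n)%nat -> 1 <= deg n adj v) ->
  nu = 1 - 30 * phi -> 0 < nu -> 0 < phi -> kap = 5 / nu ^ (2 * t) ->
  (forall v, (v < n)%nat -> f v = y v + kap * walkn n adj (2 * t) y v) ->
  wip n (deg n adj) f f - wip n (deg n adj) f (walk n adj f) <= phi * wip n (deg n adj) f f ->
  let g := fun v => kap * walkn n adj (2 * t) y v in
  let w := fun v => kap * walkn n adj t y v in
  30 * wip n (deg n adj) y y <= wip n (deg n adj) f f /\
  wip n (deg n adj) g g <= wip n (deg n adj) f f /\
  nu ^ (2 * t) * (2 * wip n (deg n adj) w w) <= 5 * wip n (deg n adj) f f.
Proof.
  intros Hg Hd Hnu Hnu0 Hphi Hkap Hf HR g w.
  assert (Hp : 0 < nu ^ (2 * t)) by (apply pow_lt; auto).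
  assert (Hk : 0 < kap) by (rewrite Hkap; apply Rdiv_lt_0_compat; lra).
  assert (Hkp : kap * nu ^ (2 * t) = 5) by (rewrite Hkap; field; lra).
  set (a j := wip n (deg n adj) y (walkn n adj j y)).
  assert (Ha : forall j, 0 <= a j) by (intros; apply moment_nonneg; auto).
  assert (Hev : forall j, a (S (2 * j)) <= a (2 * j)%nat) by (intros; apply moment_even_step_le; auto).
  set (h := fun v => 1 * y v + kap * walkn n adj (2 * t) y v).
  assert (Hfh : forall v, (v < n)%nat -> f v = h v) by (intros; unfold h; rewrite Hf by auto; ring).
  (* As [f = (1 + kap W^{2t}) y], all the quantities involved expand in the moments [a j] of [y]. *)
  assert (EF : wip n (deg n adj) f f = a O + 2 * kap * a (2 * t)%nat + kap * kap * a (2 * (2 * t))%nat).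
  { rewrite (wip_ext _ _ _ _ h h Hfh Hfh). unfold h.
    rewrite wip_lin_l, !wip_lin_r.
    rewrite (wip_sym n _ (walkn n adj (2 * t) y) y), wip_walkn by auto.
    replace (2 * t + 2 * t)%nat with (2 * (2 * t))%nat by lia.
    change (wip n (deg n adj) y y) with (a O). unfold a. ring. }
  assert (EW : wip n (deg n adj) f (walk n adj f)
      = a 1%nat + 2 * kap * a (S (2 * t)) + kap * kap * a (S (2 * (2 * t)))).
  { rewrite (wip_ext _ _ _ (walk n adj f) h (fun v => 1 * walkn n adj 1 y v + kap * walkn n adj 1 (walkn n adj (2 * t) y) v) Hfh).
    2:{ intros v _. rewrite <- walkn_lin. apply walk_ext. exact Hfh. }
    unfold h. rewrite walkn_add, wip_lin_l, !wip_lin_r, !wip_walkn by auto.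
    replace (2 * t + (1 + 2 * t))%nat with (S (2 * (2 * t))) by lia.
    replace (2 * t + 1)%nat with (S (2 * t)) by lia.
    replace (1 + 2 * t)%nat with (S (2 * t)) by lia. unfold a. ring. }
  assert (Eg : wip n (deg n adj) g g = kap * kap * a (2 * (2 * t))%nat).
  { unfold a. replace (2 * (2 * t))%nat with (2 * t + 2 * t)%nat by lia.
    rewrite <- wip_walkn by auto. unfold g, wip. rewrite <- rsum_scal.
    apply rsum_ext; intros; ring. }
  assert (Ew : wip n (deg n adj) w w = kap * kap * a (2 * t)%nat).
  { unfold a. replace (2 * t)%nat with (t + t)%nat by lia.
    rewrite <- wip_walkn by auto. unfold w, wip. rewrite <- rsum_scal.
    apply rsum_ext; intros; ring. }
  change (wip n (deg n adj) y y) with (a O).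
  set (F := wip n (deg n adj) f f) in *.
  assert (Hkk : 0 < kap * kap) by nra.
  assert (H1 : 0 <= kap * a (2 * t)%nat) by (apply Rmult_le_pos; [lra|auto]).
  assert (H2 : 0 <= kap * kap * a (2 * (2 * t))%nat) by (apply Rmult_le_pos; [lra|auto]).
  assert (H0 := Ha O).
  repeat split.
  (* If [F < 30 * a O], the gap [a O - a 1 <= phi * F] forces [nu * a O <= a 1]. With
     [kap * nu ^ (2 * t) = 5], the two further terms of [F] are then at least [10 * a O] and
     [25 * a O], so that [F >= 36 * a O], a contradiction. *)
  - apply Rnot_lt_le; intros Hlt.
    assert (Hgap : a O - a 1%nat <= phi * F).
    { assert (E1 := Hev t). assert (E2 := Hev (2 * t)%nat).
      assert (kap * a (S (2 * t)) <= kap * a (2 * t)%nat) by (apply Rmult_le_compat_l; lra).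
      assert (kap * kap * a (S (2 * (2 * t))) <= kap * kap * a (2 * (2 * t))%nat)
        by (apply Rmult_le_compat_l; lra). lra. }
    assert (Hr : nu * a O <= a 1%nat) by (subst nu; nra).
    assert (R1 := moment_ratio n adj y nu Hg Hd ltac:(lra) Hr O (2 * t)).
    rewrite Nat.add_0_r in R1.
    assert (R2 := moment_ratio n adj y nu Hg Hd ltac:(lra) Hr (2 * t)%nat (2 * t)).
    replace (2 * t + 2 * t)%nat with (2 * (2 * t))%nat in R2 by lia.
    change (nu ^ (2 * t) * a O <= a (2 * t)%nat) in R1.
    change (nu ^ (2 * t) * a (2 * t)%nat <= a (2 * (2 * t))%nat) in R2.
    assert (kap * (nu ^ (2 * t) * a O) <= kap * a (2 * t)%nat) by (apply Rmult_le_compat_l; lra).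
    assert (kap * (nu ^ (2 * t) * a (2 * t)%nat) <= kap * a (2 * (2 * t))%nat) by (apply Rmult_le_compat_l; lra).
    rewrite <- !Rmult_assoc, Hkp in H, H3.
    assert (kap * (5 * a (2 * t)%nat) <= kap * (kap * a (2 * (2 * t))%nat)) by (apply Rmult_le_compat_l; lra).
    lra.
  - rewrite Eg. lra.
  - rewrite Ew. replace (nu ^ (2 * t) * (2 * (kap * kap * a (2 * t)%nat)))
      with ((kap * nu ^ (2 * t)) * (2 * (kap * a (2 * t)%nat))) by ring.
    rewrite Hkp. lra.
Qed.
(** * Clusters and the Gram matrix *)

Definition indic (C : nat -> bool) (v : nat) : R := if C v then 1 else 0.

(** One coefficient vector is shared by the cluster indicators and their regularized counterparts,
    so that all of these depend linearly on [al]. *)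
Definition comb (q : nat) (X : nat -> nat -> R) (al : nat -> R) (v : nat) : R :=
  rsum q (fun i => al i * X i v).

Definition cluster_comb (q : nat) (C : nat -> nat -> bool) : (nat -> R) -> nat -> R :=
  comb q (fun i => indic (C i)).

Lemma cluster_comb_sq n q C al v :
  (forall i j u, (i < q)%nat -> (j < q)%nat -> i <> j -> (u < n)%nat ->
     ~ (C i u = true /\ C j u = true)) -> (v < n)%nat ->
  cluster_comb q C al v * cluster_comb q C al v
  = rsum q (fun i => al i * al i * indic (C i) v).
Proof.
  intros HC Hv. unfold cluster_comb, comb. rewrite rsum_sq_disjoint.
  - apply rsum_ext; intros i Hi. unfold indic. destruct (C i v); ring.
  - intros i j Hi Hj Hij. specialize (HC i j v Hi Hj Hij Hv). unfold indic.
    destruct (C i v), (C j v); try ring. tauto.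
Qed.

Lemma cluster_comb_norm n adj q C al :
  (forall i j u, (i < q)%nat -> (j < q)%nat -> i <> j -> (u < n)%nat ->
     ~ (C i u = true /\ C j u = true)) ->
  wip n (deg n adj) (cluster_comb q C al) (cluster_comb q C al)
  = rsum q (fun i => al i * al i * vol n adj (C i)).
Proof.
  intros HC. unfold wip, vol.
  rewrite (rsum_ext q _ (fun i => rsum n (fun v => deg n adj v * (al i * al i * indic (C i) v)))).
  - rewrite <- rsum_swap. apply rsum_ext; intros v Hv.
    rewrite (cluster_comb_sq n) by auto. now rewrite rsum_scal.
  - intros. rewrite <- rsum_scal. apply rsum_ext; intros. unfold indic. destruct (C i i0); ring.
Qed.

(** An edge contributes only through the clusters it leaves: [f u - f v = p u v - p v u]. Bounding
    the square by [2 (p u v)^2 + 2 (p v u)^2] uses up exactly the factor 1/4 of the Dirichlet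
    form. *)
Lemma cluster_comb_rayleigh n adj q C al :
  simple_graph n adj -> (forall v, (v < n)%nat -> 1 <= deg n adj v) ->
  (forall i j u, (i < q)%nat -> (j < q)%nat -> i <> j -> (u < n)%nat ->
     ~ (C i u = true /\ C j u = true)) ->
  let f := cluster_comb q C al in
  wip n (deg n adj) f f - wip n (deg n adj) f (walk n adj f)
  <= rsum q (fun i => al i * al i * cut n adj (C i)).
Proof.
  intros Hg Hd HC f.
  set (p u v := rsum q (fun i => al i * (indic (C i) u * (1 - indic (C i) v)))).
  assert (Hp : rsum n (fun u => rsum n (fun v => adjm adj u v * (p u v * p u v)))
               = rsum q (fun i => al i * al i * cut n adj (C i))).
  { transitivity (rsum n (fun u => rsum q (fun i => rsum n (fun v =>
        adjm adj u v * (al i * al i * (indic (C i) u * (1 - indic (C i) v))))))).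
    - apply rsum_ext; intros u Hu. rewrite <- rsum_swap. apply rsum_ext; intros v Hv.
      (* At most one cluster contains [u], so the square has no cross terms. *)
      rewrite rsum_scal. f_equal. unfold p. rewrite rsum_sq_disjoint.
      + apply rsum_ext; intros i Hi. unfold indic. destruct (C i u), (C i v); ring.
      + intros i j Hi Hj Hij. specialize (HC i j u Hi Hj Hij Hu). unfold indic.
        destruct (C i u), (C j u); try ring. tauto.
    - rewrite rsum_swap. apply rsum_ext; intros i _. unfold cut. rewrite <- rsum_scal.
      apply rsum_ext; intros u _. rewrite <- rsum_scal. apply rsum_ext; intros v _.
      unfold adjm, indic. destruct (C i u), (C i v), (adj u v); simpl; ring. }
  assert (Hp' : rsum n (fun u => rsum n (fun v => adjm adj u v * (p v u * p v u)))
               = rsum q (fun i => al i * al i * cut n adj (C i))).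
  { rewrite <- Hp, rsum_swap. do 2 (apply rsum_ext; intros). now rewrite (adjm_sym n). }
  rewrite wip_walk_dirichlet by auto.
  enough (rsum n (fun u => rsum n (fun v => adjm adj u v * ((f u - f v) * (f u - f v))))
    <= 2 * rsum n (fun u => rsum n (fun v => adjm adj u v * (p u v * p u v)))
     + 2 * rsum n (fun u => rsum n (fun v => adjm adj u v * (p v u * p v u)))) by lra.
  rewrite <- !rsum_scal, <- rsum_plus. apply rsum_le; intros u _.
  rewrite <- !rsum_scal, <- rsum_plus. apply rsum_le; intros v _.
  replace (f u - f v) with (p u v - p v u).
  - assert (0 <= adjm adj u v) by (unfold adjm; destruct adj; lra).
    assert (0 <= adjm adj u v * ((p u v + p v u) * (p u v + p v u)))
      by (apply Rmult_le_pos; [auto|apply Rle_0_sqr]). lra.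
  - unfold f, p, cluster_comb, comb. rewrite <- !rsum_minus. apply rsum_ext; intros; ring.
Qed.

(* Where [g v] is below the threshold, [y = f - g] is of the order of [f]; since [y] has little
   mass, the threshold must be exceeded on a constant fraction of the volume. *)
Lemma hit_volume n adj q beta S (f g y : nat -> R) :
  (1 <= q)%nat -> 0 < beta -> 0 < S ->
  (forall v, (v < n)%nat -> f v = g v + y v) ->
  (forall v, (v < n)%nat -> f v * f v <= S) ->
  beta * volV n adj / INR q * S <= wip n (deg n adj) f f ->
  30 * wip n (deg n adj) y y <= wip n (deg n adj) f f ->
  beta * volV n adj / (2 * INR q)
  <= rsum n (fun v => if Rle_dec (beta / (5 * INR q) * S) (g v * g v) then deg n adj v else 0).
Proof.
  intros Hq Hb HS Hf HfS HF Hy.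
  assert (Hq' : 1 <= INR q) by (replace 1 with (INR 1) by reflexivity; apply le_INR; auto).
  set (tau := beta / (5 * INR q) * S).
  set (hv := rsum n _).
  (* Per unit of degree, a hit contributes at most [S], and a miss at most [2 y^2 + 2 tau] because
     [f = g + y]. *)
  assert (Hmain : wip n (deg n adj) f f
    <= 2 * wip n (deg n adj) y y + 2 * tau * volV n adj + S * hv).
  { unfold wip, volV, vol, hv. rewrite <- !rsum_scal, <- !rsum_plus.
    apply rsum_le; intros v Hv.
    assert (Hd := deg_nonneg n adj v). set (dv := deg n adj v) in *.
    specialize (HfS v Hv). specialize (Hf v Hv).
    destruct (Rle_dec tau (g v * g v)) as [Hh|Hh].
    - assert (0 <= dv * (y v * y v)) by (apply Rmult_le_pos; [auto|apply Rle_0_sqr]).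
      assert (dv * (f v * f v) <= dv * S) by (apply Rmult_le_compat_l; auto).
      assert (0 <= tau) by (apply Rmult_le_pos; [apply Rlt_le, Rdiv_lt_0_compat; lra|lra]).
      assert (0 <= tau * dv) by (apply Rmult_le_pos; auto). lra.
    - assert (f v * f v <= 2 * (y v * y v) + 2 * tau).
      { assert (0 <= (g v - y v) * (g v - y v)) by apply Rle_0_sqr. rewrite Hf. lra. }
      assert (dv * (f v * f v) <= dv * (2 * (y v * y v) + 2 * tau)) by (apply Rmult_le_compat_l; auto).
      lra. }
  set (b := beta * volV n adj / INR q) in *.
  assert (Ht : tau * volV n adj = b * S / 5) by (unfold tau, b; field; lra).
  replace (beta * volV n adj / (2 * INR q)) with (b / 2) by (unfold b; field; lra).
  assert (0 <= b).
  { unfold b. apply Rmult_le_pos; [|apply Rlt_le, Rinv_0_lt_compat; lra].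
    apply Rmult_le_pos; [lra|]. apply rsum_nonneg; intros; apply deg_nonneg. }
  (* The [y] term takes at most 1/15 of the squared norm of [f] and the threshold term
     [2/5 * b * S], which leaves at least [8/15 * b * S]. *)
  assert (b / 2 * S <= hv * S) by nra.
  apply Rmult_le_reg_r with S; auto.
Qed.

(** One half of Courant-Fischer: in the eigenbasis such a [z] only has coefficients of index at
    least [h], where the eigenvalues are at most [mu h]. *)
Lemma spectrum_form_le m B mu :
  is_spectrum m B mu -> forall h, (h < m)%nat ->
  exists w : nat -> nat -> R, forall z,
    (forall i, (i < h)%nat -> rsum m (fun r => z r * w i r) = 0) ->
    rsum m (fun r => rsum m (fun l => B r l * z l) * z r) <= mu h * rsum m (fun l => z l * z l).
Proof.
  intros [Hmu [w [Hon Hev]]] h Hh. exists w. intros z Hz.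
  set (c i := rsum m (fun r => z r * w i r)).
  assert (Hexp : forall l, (l < m)%nat -> z l = rsum m (fun i => c i * w i l))
    by (intros; apply orthonormal_expansion; auto).
  (* Parseval in the eigenbasis, used with [e = mu * c] for the form and with [e = c] for the
     norm. *)
  assert (Hnorm : forall e, rsum m (fun r => rsum m (fun i => e i * w i r) * z r)
                            = rsum m (fun i => e i * c i)).
  { intros e.
    rewrite (rsum_ext m _ (fun r => rsum m (fun i => e i * (z r * w i r)))).
    - rewrite rsum_swap. apply rsum_ext; intros. apply rsum_scal.
    - intros. rewrite Rmult_comm, <- rsum_scal. apply rsum_ext; intros; ring. }
  rewrite (rsum_ext m _ (fun r => rsum m (fun i => (mu i * c i) * w i r) * z r)).
  2:{ intros r Hr. f_equal.
      rewrite (rsum_ext m _ (fun l => rsum m (fun i => c i * (B r l * w i l)))).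
      - rewrite rsum_swap. apply rsum_ext; intros. rewrite rsum_scal, Hev by auto. ring.
      - intros l Hl. rewrite (Hexp l Hl), <- rsum_scal. apply rsum_ext; intros; ring. }
  rewrite (rsum_ext m (fun l => z l * z l) (fun r => rsum m (fun i => c i * w i r) * z r))
    by (intros l Hl; now rewrite <- (Hexp l Hl)).
  rewrite !Hnorm, <- rsum_scal. apply rsum_le; intros i Hi.
  destruct (Nat.lt_ge_cases i h) as [Hih|Hih].
  - unfold c at 2 3 4. rewrite Hz by auto. lra.
  - assert (mu i <= mu h) by auto. assert (0 <= c i * c i) by apply Rle_0_sqr. nra.
Qed.

(** Orthogonality to the first [k] eigenvectors puts [k] conditions on [k + 1] coefficients and so
    has a nonzero solution, which is normalized. Requiring [z] to be nonzero takes the place of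
    linear independence of the [Z i]. *)
Lemma spectrum_lower_bound m B mu k (Z : nat -> nat -> R) c :
  is_spectrum m B mu -> (k < m)%nat ->
  (forall al, rsum (S k) (fun i => al i * al i) = 1 ->
     let z := fun j => rsum (S k) (fun i => al i * Z i j) in
     0 < rsum m (fun j => z j * z j) /\
     c * rsum m (fun j => z j * z j) <= rsum m (fun r => rsum m (fun l => B r l * z l) * z r)) ->
  c <= mu k.
Proof.
  intros Hsp Hk HZ.
  destruct (spectrum_form_le m B mu Hsp k Hk) as [w Hw].
  destruct (underdetermined_kernel k (fun r i => rsum m (fun l => Z i l * w r l)))
    as [x [[i0 [Hi0 Hx0]] Hx]].
  assert (Hpos : 0 < rsum (S k) (fun i => x i * x i)).
  { apply Rlt_le_trans with (x i0 * x i0); [nra|].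
    apply (rsum_term_le (S k) (fun i => x i * x i)); auto. intros; apply Rle_0_sqr. }
  set (S0 := rsum (S k) (fun i => x i * x i)) in *.
  assert (Hs : 0 < sqrt S0) by (apply sqrt_lt_R0; auto).
  set (al i := / sqrt S0 * x i).
  destruct (HZ al) as [H1 H2].
  { rewrite (rsum_ext _ _ (fun i => / (sqrt S0 * sqrt S0) * (x i * x i)))
      by (intros; unfold al; field; lra).
    rewrite rsum_scal, sqrt_sqrt by lra. fold S0. field; lra. }
  assert (H3 := fun Hz => Hw (fun j => rsum (S k) (fun i => al i * Z i j)) Hz).
  simpl in H1, H2, H3.
  match type of H1 with 0 < ?X => apply Rmult_le_reg_r with X; [exact H1|] end.
  eapply Rle_trans; [exact H2|]. apply H3.
  intros r Hr.
  change (rsum m (fun j => rsum (S k) (fun i => al i * Z i j) * w r j) = 0).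
  rewrite (rsum_ext m _ (fun j => rsum (S k) (fun i => / sqrt S0 * (x i * (Z i j * w r j))))).
  - rewrite rsum_swap.
    rewrite (rsum_ext _ _ (fun i => / sqrt S0 * (rsum m (fun l => Z i l * w r l) * x i))).
    + rewrite rsum_scal, Hx by auto. ring.
    + intros. rewrite !rsum_scal. ring.
  - intros. rewrite (Rmult_comm (rsum _ _)), <- rsum_scal. apply rsum_ext; intros; unfold al; ring.
Qed.

(** * The Gram matrix of a sample *)

Lemma gram_form n adj t a s z :
  rsum s (fun i => rsum s (fun j => gram n adj t a i j * z j) * z i)
  = rsum n (fun v => rsum s (fun j => embed n adj t a v j * z j)
                     * rsum s (fun j => embed n adj t a v j * z j)).
Proof.
  transitivity (rsum n (fun v => rsum s (fun i => rsum s (fun j =>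
     embed n adj t a v i * z i * (embed n adj t a v j * z j))))).
  2:{ apply rsum_ext; intros. now rewrite rsum_mult. }
  rewrite rsum_swap. apply rsum_ext; intros i _.
  rewrite rsum_swap. rewrite Rmult_comm, <- rsum_scal. apply rsum_ext; intros j _.
  unfold gram.
  replace (z i * (_ * z j)) with (z i * z j * rsum n (fun v => embed n adj t a v i * embed n adj t a v j)) by ring.
  rewrite <- rsum_scal. apply rsum_ext; intros; ring.
Qed.

(** The eigenvalue is the squared norm of the embedding applied to a unit eigenvector. This settles
    the boundary case [phi = 1/30], where the claimed bound is 0. *)
Lemma gram_spectrum_nonneg n adj t a s mu k :
  is_spectrum s (gram n adj t a) mu -> (k < s)%nat -> 0 <= mu k.
Proof.
  intros [_ [w [Hon Hev]]] Hk.
  assert (H := gram_form n adj t a s (w k)).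
  rewrite (rsum_ext s _ (fun i => mu k * (w k i * w k i))) in H
    by (intros; rewrite Hev by auto; ring).
  rewrite rsum_scal, Hon, Nat.eqb_refl in H by auto.
  assert (0 <= rsum n (fun v => rsum s (fun j => embed n adj t a v j * w k j)
                     * rsum s (fun j => embed n adj t a v j * w k j)))
    by (apply rsum_nonneg; intros; apply Rle_0_sqr). lra.
Qed.

(* If [X] is the embedding matrix and [z = X^T D^{1/2} w], then [|z|^2 = <X z, D^{1/2} w>]. *)
Lemma gram_form_ge n adj t a s w (z : nat -> R) :
  (forall v, (v < n)%nat -> 1 <= deg n adj v) ->
  (forall j, (j < s)%nat -> (nth j a O < n)%nat) ->
  (forall j, (j < s)%nat -> z j = walkn n adj t w (nth j a O)) ->
  rsum s (fun j => z j * z j) * rsum s (fun j => z j * z j)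
  <= rsum s (fun i => rsum s (fun j => gram n adj t a i j * z j) * z i)
     * wip n (deg n adj) w w.
Proof.
  intros Hd Ha Hz.
  assert (E : rsum s (fun j => z j * z j)
    = rsum n (fun v => rsum s (fun j => embed n adj t a v j * z j) * (sqrt (deg n adj v) * w v))).
  { rewrite (rsum_ext n _ (fun v => rsum s (fun j => z j * (mpow n (lazyM n adj) t v (nth j a O) * w v)))).
    - rewrite rsum_swap. apply rsum_ext; intros j Hj.
      rewrite rsum_scal, walkn_mpow by auto. now rewrite <- Hz.
    - intros v Hv. rewrite Rmult_comm, <- rsum_scal. apply rsum_ext; intros j Hj.
      unfold embed. field. apply Rgt_not_eq, sqrt_lt_R0. specialize (Hd v Hv). lra. }
  assert (E' : wip n (deg n adj) w w
    = rsum n (fun v => (sqrt (deg n adj v) * w v) * (sqrt (deg n adj v) * w v))).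
  { apply rsum_ext; intros v Hv. rewrite <- (sqrt_sqrt (deg n adj v)) at 1 by apply deg_nonneg. ring. }
  rewrite gram_form, E, E'. apply rsum_cauchy_schwarz.
Qed.
(** * Random samples *)

(** The same fold as in [prob], which is thus an [lsum] over [tuples] by conversion. *)
Definition lsum {A : Type} (l : list A) (f : A -> R) : R :=
  fold_right (fun a acc => f a + acc) 0 l.

Lemma lsum_app A (l l' : list A) f : lsum (l ++ l') f = lsum l f + lsum l' f.
Proof. induction l as [|a l IH]; simpl; [ring|rewrite IH; ring]. Qed.

Lemma lsum_map A B (h : A -> B) l f : lsum (map h l) f = lsum l (fun a => f (h a)).
Proof. induction l as [|a l IH]; simpl; [reflexivity|now rewrite IH]. Qed.

Lemma lsum_ext A (l : list A) f g : (forall a, In a l -> f a = g a) -> lsum l f = lsum l g.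
Proof. induction l as [|a l IH]; simpl; intros H; [auto|rewrite IH, H; auto]. Qed.

Lemma lsum_le A (l : list A) f g : (forall a, In a l -> f a <= g a) -> lsum l f <= lsum l g.
Proof. induction l as [|a l IH]; simpl; intros H; [lra|apply Rplus_le_compat; auto]. Qed.

Lemma lsum_scal A (l : list A) c f : lsum l (fun a => c * f a) = c * lsum l f.
Proof. induction l as [|a l IH]; simpl; [ring|rewrite IH; ring]. Qed.

Lemma lsum_minus A (l : list A) f g : lsum l (fun a => f a - g a) = lsum l f - lsum l g.
Proof. induction l as [|a l IH]; simpl; [ring|rewrite IH; ring]. Qed.

Lemma lsum_plus A (l : list A) f g : lsum l (fun a => f a + g a) = lsum l f + lsum l g.
Proof. induction l as [|a l IH]; simpl; [ring|rewrite IH; ring]. Qed.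

Lemma lsum_const A (l : list A) c : lsum l (fun _ => c) = INR (length l) * c.
Proof. induction l as [|a l IH]; [simpl; ring|simpl length; rewrite S_INR; simpl; rewrite IH; ring]. Qed.

Lemma lsum_swap A B (l : list A) (l' : list B) f :
  lsum l (fun a => lsum l' (f a)) = lsum l' (fun b => lsum l (fun a => f a b)).
Proof.
  induction l as [|a l IH]; simpl.
  - rewrite lsum_const. ring.
  - rewrite IH. symmetry. apply lsum_plus.
Qed.

Lemma lsum_nonneg A (l : list A) f : (forall a, In a l -> 0 <= f a) -> 0 <= lsum l f.
Proof.
  intros H. replace 0 with (lsum l (fun _ => 0)) by (rewrite lsum_const; ring).
  now apply lsum_le.
Qed.

Lemma lsum_term_le A (l : list A) f a :
  (forall b, In b l -> 0 <= f b) -> In a l -> f a <= lsum l f.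
Proof.
  induction l as [|b l IH]; simpl; intros H; [tauto|intros [->|Hin]].
  - assert (0 <= lsum l f) by (apply lsum_nonneg; auto). lra.
  - assert (f a <= lsum l f) by auto. assert (0 <= f b) by auto. lra.
Qed.

Lemma lsum_rsum_nth (a : list nat) f : rsum (length a) (fun j => f (nth j a O)) = lsum a f.
Proof.
  induction a as [|v a IH]; [reflexivity|].
  simpl length. rewrite rsum_shift. simpl. now rewrite IH.
Qed.

Lemma lsum_seq n f : lsum (seq 0 n) f = rsum n f.
Proof.
  rewrite <- (length_seq n 0) at 2. rewrite <- lsum_rsum_nth.
  rewrite length_seq. apply rsum_ext; intros. rewrite seq_nth by auto. reflexivity.
Qed.

Lemma lsum_tuples_S n s f :
  lsum (tuples n (S s)) f = rsum n (fun v => lsum (tuples n s) (fun a => f (v :: a))).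
Proof.
  rewrite <- lsum_seq. simpl tuples. generalize (seq 0 n); intros l.
  induction l as [|v l IH]; simpl; [reflexivity|].
  rewrite lsum_app, lsum_map, IH. reflexivity.
Qed.

Lemma in_tuples n s a :
  In a (tuples n s) <-> length a = s /\ forall v, In v a -> (v < n)%nat.
Proof.
  revert a; induction s as [|s IH]; intros a; simpl.
  - split.
    + intros [<-|[]]. simpl. tauto.
    + intros [H _]. destruct a; [auto|discriminate].
  - rewrite in_flat_map. split.
    + intros [v [Hv Ha]]. apply in_map_iff in Ha. destruct Ha as [b [<- Hb]].
      apply IH in Hb. apply in_seq in Hv. simpl. split; [lia|].
      intros u [<-|Hu]; [lia|]. now apply Hb.
    + intros [Hl Hv]. destruct a as [|v a]; [discriminate|].
      exists v. split; [apply in_seq; specialize (Hv v (or_introl eq_refl)); lia|].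
      apply in_map, IH. simpl in Hl. split; [lia|]. intros; apply Hv; simpl; auto.
Qed.

Lemma tuples_length n s : INR (length (tuples n s)) = INR n ^ s.
Proof.
  induction s as [|s IH]; [simpl; lra|].
  rewrite <- (Rmult_1_r (INR _)), <- lsum_const, lsum_tuples_S.
  rewrite (rsum_ext n _ (fun _ => INR n ^ s)).
  - rewrite rsum_const. reflexivity.
  - intros. rewrite lsum_const, IH. ring.
Qed.

(** Independence of the samples: the expectation of a product with one factor per sample is a
    power. *)
Lemma tuples_product n s P (h : nat -> R) :
  lsum (tuples n s) (fun a => weight P a * fold_right (fun v acc => h v * acc) 1 a)
  = rsum n (fun v => P v * h v) ^ s.
Proof.
  induction s as [|s IH]; [simpl; ring|].
  rewrite lsum_tuples_S. simpl pow. rewrite <- IH.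
  rewrite (rsum_ext n _ (fun v => lsum (tuples n s)
    (fun a => weight P a * fold_right (fun v acc => h v * acc) 1 a) * (P v * h v))).
  - rewrite rsum_scal. ring.
  - intros v _. rewrite Rmult_comm, <- lsum_scal. apply lsum_ext; intros. simpl. ring.
Qed.

Lemma weight_nonneg n s P a :
  (forall v, (v < n)%nat -> 0 <= P v) -> In a (tuples n s) -> 0 <= weight P a.
Proof.
  intros HP Ha. apply in_tuples in Ha. destruct Ha as [_ Ha].
  induction a as [|v a IH]; simpl; [lra|].
  apply Rmult_le_pos; [apply HP, Ha; simpl; auto|apply IH; intros; apply Ha; simpl; auto].
Qed.

Lemma weight_total n s P : rsum n P = 1 -> lsum (tuples n s) (weight P) = 1.
Proof.
  intros HP. rewrite <- (pow1 s), <- HP at 1.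
  rewrite (rsum_ext n P (fun v => P v * 1)) by (intros; ring).
  rewrite <- (tuples_product n s P (fun _ => 1)).
  apply lsum_ext; intros a _.
  replace (fold_right (fun (_ : nat) acc => 1 * acc) 1 a) with 1; [ring|].
  induction a; simpl; [auto|rewrite <- IHa; ring].
Qed.

Lemma fold_exp (f : nat -> R) a :
  fold_right (fun v acc => exp (- f v) * acc) 1 a = exp (- lsum a f).
Proof.
  induction a as [|v a IH]; simpl; [rewrite Ropp_0, exp_0; auto|].
  rewrite IH, <- exp_plus. f_equal. ring.
Qed.

Lemma pow_exp x s : exp x ^ s = exp (INR s * x).
Proof.
  induction s as [|s IH]; [simpl; rewrite Rmult_0_l, exp_0; auto|].
  rewrite S_INR. simpl. rewrite IH, <- exp_plus. f_equal. ring.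
Qed.

(** Chernoff's argument: by independence the Laplace transform is an [s]-th power, and its base is
    at most [1 - p / 2 <= exp (- (p / 2))] because [exp (-1) <= 1 / 2]. *)
Lemma hits_laplace n s P (hit : nat -> bool) p :
  (forall v, (v < n)%nat -> 0 <= P v) -> rsum n P = 1 ->
  p <= rsum n (fun v => if hit v then P v else 0) ->
  lsum (tuples n s) (fun a => weight P a * exp (- lsum a (indic hit))) <= exp (- (p * INR s / 2)).
Proof.
  intros HP H1 Hp.
  rewrite (lsum_ext _ _ _ (fun a => weight P a * fold_right (fun v acc => exp (- indic hit v) * acc) 1 a))
    by (intros; now rewrite fold_exp).
  rewrite (tuples_product n s P (fun v => exp (- indic hit v))).
  replace (- (p * INR s / 2)) with (INR s * (- (p / 2))) by field.
  rewrite <- pow_exp. apply pow_incr. split.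
  - apply rsum_nonneg; intros. apply Rmult_le_pos; [auto|apply Rlt_le, exp_pos].
  - apply Rle_trans with (1 - p / 2).
    + apply Rle_trans with (rsum n (fun v => P v - / 2 * (if hit v then P v else 0))).
      * apply rsum_le; intros v Hv. specialize (HP v Hv). unfold indic.
        destruct (hit v).
        -- assert (exp (- (1)) <= / 2).
           { rewrite exp_Ropp. apply Rinv_le_contravar; [lra|].
             assert (H := exp_ineq1 1 ltac:(lra)). lra. }
           nra.
        -- rewrite Ropp_0, exp_0. lra.
      * rewrite rsum_minus, rsum_scal, H1. lra.
    + assert (H := exp_ineq1_le (- (p / 2))). lra.
Qed.

(** Markov's inequality for [exp (H - hits)], summed over [L]. *)
Lemma few_hits_union_bound (B : Type) (L : list B) n s P (hit : B -> nat -> bool) p H :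
  (forall v, (v < n)%nat -> 0 <= P v) -> rsum n P = 1 ->
  (forall b, In b L -> p <= rsum n (fun v => if hit b v then P v else 0)) ->
  exists Good : list nat -> bool,
    (forall a, Good a = true -> forall b, In b L -> H <= lsum a (indic (hit b))) /\
    1 - INR (length L) * exp (H - p * INR s / 2) <= prob n s P Good.
Proof.
  intros HP H1 Hp.
  set (enough_hits a b := if Rle_dec H (lsum a (indic (hit b))) then true else false).
  exists (fun a => forallb (enough_hits a) L). split.
  - intros a Ha b Hb. rewrite forallb_forall in Ha. specialize (Ha b Hb).
    unfold enough_hits in Ha. destruct Rle_dec; [auto|discriminate].
  - change (prob n s P (fun a => forallb (enough_hits a) L))
      with (lsum (tuples n s) (fun a => if forallb (enough_hits a) L then weight P a else 0)).
    apply Rle_trans with (lsum (tuples n s) (fun a => weight P a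
       - lsum L (fun b => exp H * (weight P a * exp (- lsum a (indic (hit b))))))).
    + rewrite lsum_minus, weight_total by auto. rewrite lsum_swap.
      assert (lsum L (fun b => lsum (tuples n s) (fun a => exp H * (weight P a * exp (- lsum a (indic (hit b))))))
              <= lsum L (fun _ => exp (H - p * INR s / 2))).
      { apply lsum_le; intros b Hb. rewrite lsum_scal.
        unfold Rminus. rewrite exp_plus. apply Rmult_le_compat_l; [apply Rlt_le, exp_pos|].
        apply hits_laplace; auto. }
      rewrite lsum_const in H0. lra.
    + apply lsum_le; intros a Ha.
      assert (Hw := weight_nonneg n s P a HP Ha).
      assert (Hnn : forall b, In b L -> 0 <= exp H * (weight P a * exp (- lsum a (indic (hit b))))).
      { intros. apply Rmult_le_pos; [apply Rlt_le, exp_pos|].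
        apply Rmult_le_pos; [auto|apply Rlt_le, exp_pos]. }
      destruct (forallb (enough_hits a) L) eqn:E.
      * assert (H2 := lsum_nonneg _ L _ Hnn). lra.
      * assert (Hb : exists b, In b L /\ enough_hits a b = false).
        { clear - E. induction L as [|b L IH]; simpl in E; [discriminate|].
          destruct (enough_hits a b) eqn:Eb; [|exists b; simpl; auto].
          destruct (IH E) as [b' [Hb' Eb']]. exists b'; simpl; auto. }
        destruct Hb as [b [Hb Eb]].
        assert (H2 := lsum_term_le _ L _ b Hnn Hb). simpl in H2.
        unfold enough_hits in Eb. destruct Rle_dec as [|Hlt]; [discriminate|].
        assert (H3 : 1 <= exp H * exp (- lsum a (indic (hit b)))).
        { rewrite <- exp_plus. assert (H3 := exp_ineq1_le (H + - lsum a (indic (hit b)))). lra. }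
        assert (weight P a * 1 <= weight P a * (exp H * exp (- lsum a (indic (hit b)))))
          by (apply Rmult_le_compat_l; auto).
        lra.
Qed.
(** * The lower bound *)

(** Collects the regularized solutions, each known only to exist, into one family indexed by the
    clusters. *)
Lemma finite_choice (A : Type) (x0 : A) q (Q : nat -> A -> Prop) :
  (forall i, (i < q)%nat -> exists x, Q i x) ->
  exists X, forall i, (i < q)%nat -> Q i (X i).
Proof.
  induction q as [|q IH]; intros H.
  - exists (fun _ => x0). lia.
  - destruct IH as [X HX]; [auto|]. destruct (H q) as [x Hx]; [lia|].
    exists (fun i => if Nat.eqb i q then x else X i). intros i Hi.
    destruct (Nat.eqb_spec i q) as [->|]; [auto|apply HX; lia].
Qed.

Lemma walkn_scal n adj j c x v :
  walkn n adj j (fun u => c * x u) v = c * walkn n adj j x v.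
Proof.
  revert v; induction j as [|j IH]; intros v; [reflexivity|].
  simpl. rewrite (walk_ext _ _ _ _ v (fun u _ => IH u)).
  unfold walk. rewrite <- rsum_scal. apply rsum_ext; intros; ring.
Qed.

(** Each indicator is regularized once, before [al] is given. By linearity the combinations solve
    the regularized system of [cluster_comb q C al], so the estimates hold for all [al] and [g] is
    linear in [al], as Courant-Fischer requires. *)
Lemma regularized_clusters n adj q C t phi :
  simple_graph n adj -> (forall v, (v < n)%nat -> 1 <= deg n adj v) ->
  0 < phi -> 0 < 1 - 30 * phi ->
  (forall i j u, (i < q)%nat -> (j < q)%nat -> i <> j -> (u < n)%nat ->
     ~ (C i u = true /\ C j u = true)) ->
  (forall i, (i < q)%nat -> cut n adj (C i) <= phi * vol n adj (C i)) ->
  exists G W Y : nat -> nat -> R, forall al,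
    let F := wip n (deg n adj) (cluster_comb q C al) (cluster_comb q C al) in
    (forall v, (v < n)%nat -> cluster_comb q C al v = comb q G al v + comb q Y al v) /\
    30 * wip n (deg n adj) (comb q Y al) (comb q Y al) <= F /\
    wip n (deg n adj) (comb q G al) (comb q G al) <= F /\
    (1 - 30 * phi) ^ (2 * t) * (2 * wip n (deg n adj) (comb q W al) (comb q W al)) <= 5 * F /\
    (forall v, walkn n adj t (comb q W al) v = comb q G al v).
Proof.
  intros Hg Hd Hphi Hnu HC Hcut.
  set (nu := 1 - 30 * phi) in *. set (kap := 5 / nu ^ (2 * t)).
  assert (Hk : 0 < kap) by (apply Rdiv_lt_0_compat; [lra|apply pow_lt; auto]).
  destruct (finite_choice (nat -> R) (fun _ => 0) q (fun i y => forall v, (v < n)%nat ->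
      y v + kap * walkn n adj (2 * t) y v = indic (C i) v)) as [Y HY].
  { intros i Hi. apply regularized_solution_exists; auto. lra. }
  exists (fun i v => kap * walkn n adj (2 * t) (Y i) v), (fun i v => kap * walkn n adj t (Y i) v), Y.
  intros al F.
  assert (EG : forall j v, comb q (fun i v => kap * walkn n adj j (Y i) v) al v
                           = kap * walkn n adj j (comb q Y al) v).
  { intros j v. unfold comb. rewrite walkn_sum, <- rsum_scal. apply rsum_ext; intros; ring. }
  assert (Hf : forall v, (v < n)%nat -> cluster_comb q C al v
     = comb q Y al v + kap * walkn n adj (2 * t) (comb q Y al) v).
  { intros v Hv. rewrite <- EG. unfold cluster_comb, comb. rewrite <- rsum_plus.
    apply rsum_ext; intros i Hi. rewrite <- HY by auto. ring. }
  assert (HR : wip n (deg n adj) (cluster_comb q C al) (cluster_comb q C al)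
     - wip n (deg n adj) (cluster_comb q C al) (walk n adj (cluster_comb q C al)) <= phi * F).
  { eapply Rle_trans; [apply cluster_comb_rayleigh; auto|].
    unfold F. rewrite cluster_comb_norm, <- rsum_scal by auto. apply rsum_le; intros i Hi.
    specialize (Hcut i Hi). assert (0 <= al i * al i) by apply Rle_0_sqr. nra. }
  destruct (regularized_solution_bounds n adj t phi _ (comb q Y al) nu kap Hg Hd eq_refl Hnu Hphi eq_refl Hf HR)
    as [H1 [H2 H3]].
  repeat split; auto.
  - intros v Hv. rewrite EG, Hf by auto. ring.
  - rewrite (wip_ext _ _ _ _ _ _ (fun v _ => EG _ v) (fun v _ => EG _ v)). exact H2.
  - rewrite (wip_ext _ _ _ _ _ _ (fun v _ => EG _ v) (fun v _ => EG _ v)). exact H3.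
  - intros v. rewrite EG. unfold comb at 1. rewrite walkn_sum.
    replace (2 * t)%nat with (t + t)%nat by lia. unfold comb.
    rewrite walkn_sum, <- rsum_scal. apply rsum_ext; intros i Hi.
    rewrite walkn_scal, walkn_add. ring.
Qed.

(** * A grid of coefficient vectors *)

Definition gridpt (m : nat) (b : list nat) (i : nat) : R := (INR (nth i b O) - INR m) / INR m.

Lemma nat_near M x : 0 <= x <= INR M -> exists c, (c <= M)%nat /\ Rabs (x - INR c) <= 1.
Proof.
  induction M as [|M IH]; intros Hx.
  - exists O. simpl in *. split; [lia|]. apply Rabs_le; lra.
  - destruct (Rle_dec x (INR M)) as [H|H].
    + destruct IH as [c [Hc Hxc]]; [lra|]. exists c. split; [lia|auto].
    + exists (S M). split; [lia|]. rewrite S_INR in *. apply Rabs_le; lra.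
Qed.

(** The entries [0] to [2 * m] of [b] stand for the multiples of [1 / m] from -1 to 1; each
    coordinate is rounded separately. *)
Lemma grid_near m q (al : nat -> R) :
  (1 <= m)%nat -> (forall i, (i < q)%nat -> al i * al i <= 1) ->
  exists b, In b (tuples (2 * m + 1) q) /\
    forall i, (i < q)%nat ->
      (al i - gridpt m b i) * (al i - gridpt m b i) <= / (INR m * INR m).
Proof.
  intros Hm. assert (Hm' : 1 <= INR m) by (replace 1 with (INR 1) by reflexivity; apply le_INR; auto).
  revert al; induction q as [|q IH]; intros al Hal.
  - exists nil. simpl. split; [auto|lia].
  - destruct (IH (fun i => al (S i))) as [b [Hb Hnear]]; [intros; apply Hal; lia|].
    destruct (nat_near (2 * m) (INR m * (al O + 1))) as [c [Hc Hx]].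
    { assert (H := Hal O ltac:(lia)). rewrite mult_INR. simpl (INR 2). nra. }
    exists (c :: b). split.
    + apply in_tuples. apply in_tuples in Hb. simpl. destruct Hb as [Hl Hb].
      split; [lia|]. intros v [<-|Hv]; [lia|auto].
    + intros [|i] Hi; [|apply Hnear; lia]. unfold gridpt; simpl.
      replace (al O - (INR c - INR m) / INR m) with ((INR m * (al O + 1) - INR c) * / INR m)
        by (field; lra).
      set (e := INR m * (al O + 1) - INR c) in *.
      assert (e * e <= 1).
      { unfold Rabs in Hx. destruct Rcase_abs; nra. }
      rewrite Rinv_mult. replace (e * / INR m * (e * / INR m)) with (e * e * (/ INR m * / INR m)) by ring.
      assert (0 <= / INR m * / INR m) by apply Rle_0_sqr. nra.
Qed.

Lemma nat_above x : 0 <= x -> exists m, (1 <= m)%nat /\ x <= INR m <= x + 1.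
Proof.
  intros Hx. destruct (archimed x) as [H1 H2].
  assert (H3 : (0 < up x)%Z) by (apply lt_IZR; lra).
  exists (Z.to_nat (up x)). split; [lia|].
  rewrite INR_IZR_INZ, Z2Nat.id by lia. lra.
Qed.
Lemma comb_minus q X a b v : comb q X (fun i => a i - b i) v = comb q X a v - comb q X b v.
Proof. unfold comb. rewrite <- rsum_minus. apply rsum_ext; intros; ring. Qed.

Lemma vol_le_volV n adj C : vol n adj C <= volV n adj.
Proof.
  apply rsum_le; intros v _. assert (H := deg_nonneg n adj v). destruct (C v); lra.
Qed.

(** With degrees at least 1, every vertex has at least unit weight in the norm. *)
Lemma sq_le_norm n adj (x : nat -> R) v :
  (forall v, (v < n)%nat -> 1 <= deg n adj v) -> (v < n)%nat ->
  x v * x v <= wip n (deg n adj) x x.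
Proof.
  intros Hd Hv.
  apply Rle_trans with (deg n adj v * (x v * x v)).
  - assert (0 <= x v * x v) by apply Rle_0_sqr. specialize (Hd v Hv). nra.
  - apply (rsum_term_le n (fun v => deg n adj v * (x v * x v))); auto.
    intros; apply Rmult_le_pos; [apply deg_nonneg|apply Rle_0_sqr].
Qed.

Lemma approx_deg_dist_mass n adj eta P (hit : nat -> bool) x :
  approx_deg_dist n adj eta P -> 0 < volV n adj -> eta <= 1 ->
  x * volV n adj <= rsum n (fun v => if hit v then deg n adj v else 0) ->
  (1 - eta) * x <= rsum n (fun v => if hit v then P v else 0).
Proof.
  intros [_ [_ HP]] HV He Hx.
  apply Rle_trans with ((1 - eta) / volV n adj * rsum n (fun v => if hit v then deg n adj v else 0)).
  - replace ((1 - eta) * x) with ((1 - eta) / volV n adj * (x * volV n adj)) by (field; lra).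
    apply Rmult_le_compat_l; [|auto].
    apply Rmult_le_pos; [lra|apply Rlt_le, Rinv_0_lt_compat; auto].
  - rewrite <- rsum_scal. apply rsum_le; intros v Hv. destruct (hit v); [|lra].
    specialize (HP v Hv).
    assert (H := Rle_abs (- (P v - deg n adj v / volV n adj))). rewrite Rabs_Ropp in H.
    replace ((1 - eta) / volV n adj * deg n adj v)
      with (deg n adj v / volV n adj - eta * deg n adj v / volV n adj) by (field; lra).
    lra.
Qed.

(** The condition on [m] lets a unit vector move by at most 1/2 in norm, so that the grid point
    keeps norm at least 1/2. *)
Lemma grid_point_norm m q (al be : nat -> R) :
  4 * INR q <= INR m * INR m -> (1 <= q)%nat ->
  rsum q (fun i => al i * al i) = 1 ->
  (forall i, (i < q)%nat -> (al i - be i) * (al i - be i) <= / (INR m * INR m)) ->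
  rsum q (fun i => (al i - be i) * (al i - be i)) <= INR q / (INR m * INR m) /\
  1 / 4 <= rsum q (fun i => be i * be i).
Proof.
  intros Hm Hq Hal Hnear.
  assert (Hq' : 1 <= INR q) by (replace 1 with (INR 1) by reflexivity; apply le_INR; auto).
  assert (Hd : rsum q (fun i => (al i - be i) * (al i - be i)) <= INR q / (INR m * INR m)).
  { unfold Rdiv. rewrite <- rsum_const. apply rsum_le; auto. }
  split; [exact Hd|].
  assert (Hsmall : INR q / (INR m * INR m) <= 1 / 4).
  { apply Rmult_le_reg_r with (INR m * INR m); [lra|]. unfold Rdiv at 1.
    rewrite Rmult_assoc, Rinv_l by lra. lra. }
  assert (rsum q (fun i => al i * al i)
    <= 2 * rsum q (fun i => be i * be i) + 2 * rsum q (fun i => (al i - be i) * (al i - be i))).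
  { rewrite <- !rsum_scal, <- rsum_plus. apply rsum_le; intros i _.
    assert (H := Rle_0_sqr (al i - 2 * be i)). unfold Rsqr in H. lra. }
  lra.
Qed.

(* A sample good for a nearby grid point is good for every unit vector: the deviation of [g] is
   bounded pointwise by the norm of the deviation of the indicator combination. *)
Lemma many_hits_everywhere n adj q C (G : nat -> nat -> R) beta m a b al H :
  (forall v, (v < n)%nat -> 1 <= deg n adj v) ->
  (1 <= q)%nat -> 0 < beta ->
  (forall al, wip n (deg n adj) (comb q G al) (comb q G al)
     <= wip n (deg n adj) (cluster_comb q C al) (cluster_comb q C al)) ->
  (forall al, wip n (deg n adj) (cluster_comb q C al) (cluster_comb q C al)
     <= volV n adj * rsum q (fun i => al i * al i)) ->
  0 < INR m * INR m ->
  80 * INR q * INR q * volV n adj <= beta * (INR m * INR m) ->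
  0 <= volV n adj ->
  (forall v, In v a -> (v < n)%nat) ->
  rsum q (fun i => (al i - gridpt m b i) * (al i - gridpt m b i)) <= INR q / (INR m * INR m) ->
  1 / 4 <= rsum q (fun i => gridpt m b i * gridpt m b i) ->
  H <= lsum a (indic (fun v =>
         if Rle_dec (beta / (5 * INR q) * rsum q (fun i => gridpt m b i * gridpt m b i))
                    (comb q G (gridpt m b) v * comb q G (gridpt m b) v) then true else false)) ->
  H * (beta / (80 * INR q)) <= lsum a (fun v => comb q G al v * comb q G al v).
Proof.
  intros Hd Hq Hb HG HF Hm0 Hm HV Ha Hdist Hnorm HH.
  assert (Hq' : 1 <= INR q) by (replace 1 with (INR 1) by reflexivity; apply le_INR; auto).
  set (S := rsum q (fun i => gridpt m b i * gridpt m b i)) in *.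
  assert (Hth : 0 < beta / (80 * INR q)) by (apply Rdiv_lt_0_compat; lra).
  eapply Rle_trans; [apply Rmult_le_compat_r; [lra|exact HH]|].
  rewrite Rmult_comm, <- lsum_scal. apply lsum_le; intros v Hv. specialize (Ha v Hv).
  unfold indic. destruct Rle_dec as [Hh|Hh].
  2:{ rewrite Rmult_0_r. apply Rle_0_sqr. }
  set (gb := comb q G (gridpt m b) v) in *.
  assert (Hdev : (comb q G al v - gb) * (comb q G al v - gb) <= beta / (80 * INR q)).
  { unfold gb. rewrite <- comb_minus.
    eapply Rle_trans; [apply (sq_le_norm n adj _ v Hd Ha)|].
    eapply Rle_trans; [apply HG|]. eapply Rle_trans; [apply HF|].
    eapply Rle_trans; [apply Rmult_le_compat_l; [exact HV|exact Hdist]|].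
    apply Rmult_le_reg_r with (80 * INR q * (INR m * INR m)); [apply Rmult_lt_0_compat; lra|].
    replace (volV n adj * (INR q / (INR m * INR m)) * (80 * INR q * (INR m * INR m)))
      with (80 * INR q * INR q * volV n adj) by (field; intros E; rewrite E in Hm0; lra).
    replace (beta / (80 * INR q) * (80 * INR q * (INR m * INR m))) with (beta * (INR m * INR m))
      by (field; lra).
    exact Hm. }
  (* With [theta = beta / (80 * INR q)], the threshold is [16 * S * theta >= 4 * theta] as
     [S >= 1/4]. So [gb] is at least [2 sqrt theta] in absolute value and the deviation at most
     [sqrt theta], leaving a square of at least [theta]. *)
  assert (Hgb : 4 * (beta / (80 * INR q)) <= gb * gb).
  { eapply Rle_trans; [|exact Hh].
    replace (beta / (5 * INR q) * S) with (16 * S * (beta / (80 * INR q))) by (field; lra).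
    apply Rmult_le_compat_r; lra. }
  assert (H0 := Rle_0_sqr (2 * comb q G al v - gb)). unfold Rsqr in H0. lra.
Qed.

(** The size of the grid costs [2 * INR q * ln V] in the exponent. The constant 200 leaves at least
    another [ln V], which absorbs [exp H] and the factor 3. *)
Lemma union_bound_numerics L V q H x :
  0 <= L -> (1 <= q)%nat -> 3 * exp H <= V -> 1 <= V ->
  L <= (V * V) ^ q -> 200 * INR q * ln V <= x -> L * exp (H - x) <= 1 / 3.
Proof.
  intros HL Hq HV HV1 HLe Hx.
  assert (Hq' : 1 <= INR q) by (replace 1 with (INR 1) by reflexivity; apply le_INR; auto).
  assert (Hln : 0 <= ln V).
  { rewrite <- ln_1. destruct HV1 as [HV1|<-]; [apply Rlt_le, ln_increasing; lra|lra]. }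
  assert (E : V * V = exp (2 * ln V)).
  { replace (2 * ln V) with (ln V + ln V) by ring. rewrite exp_plus, exp_ln; lra. }
  rewrite E, pow_exp in HLe.
  apply Rle_trans with (exp (INR q * (2 * ln V)) * exp (H - x)).
  - apply Rmult_le_compat_r; [apply Rlt_le, exp_pos|auto].
  - rewrite <- exp_plus. apply Rle_trans with (exp (H - ln V)).
    + destruct (Rle_lt_or_eq_dec (INR q * (2 * ln V) + (H - x)) (H - ln V)) as [Hlt|Heq].
      * nra.
      * apply Rlt_le, exp_increasing; auto.
      * rewrite Heq; lra.
    + unfold Rminus. rewrite exp_plus, exp_Ropp, exp_ln by lra.
      apply Rmult_le_reg_r with V; [lra|]. rewrite Rmult_assoc, Rinv_l by lra. lra.
Qed.

Lemma ln_ge_1 x : 3 <= x -> 1 <= ln x.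
Proof.
  intros Hx. rewrite <- (ln_exp 1).
  assert (H := exp_le_3).
  destruct (Rle_lt_or_eq_dec (exp 1) x) as [Hlt| <-]; [lra| |lra].
  apply Rlt_le, ln_increasing; [apply exp_pos|auto].
Qed.

Theorem theorem3p3 :
  forall (k : nat) (beta eta : R),
    (1 <= k)%nat -> 0 < beta < 1 -> 0 < eta <= 1 / 2 ->
    exists N : R,
      forall (n : nat) (adj : nat -> nat -> bool) (phi : R) (t : nat)
             (P : nat -> R) (s : nat),
        0 < phi <= 1 / 30 ->
        (1 <= t)%nat ->
        simple_graph n adj ->
        unclusterable n adj k phi beta ->
        (forall v, (v < n)%nat -> 1 <= deg n adj v) ->
        N <= volV n adj ->
        sample_size n adj k beta eta <= INR s < sample_size n adj k beta eta + 1 ->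
        approx_deg_dist n adj eta P ->
        exists Good : list nat -> bool,
          (forall a, In a (tuples n s) -> Good a = true ->
             forall mu, is_spectrum s (gram n adj t a) mu ->
               8 * INR (k + 1) * ln (12 * INR (k + 1))
                 / (beta * (1 - eta) * volV n adj) * (1 - 30 * phi) ^ (2 * t)
               <= mu k) /\
          2 / 3 <= prob n s P Good.
Proof.
  intros k beta eta Hk Hbeta Heta.
  replace (k + 1)%nat with (S k) by lia.
  set (q := S k). set (Q := INR q). set (l := ln (12 * Q)).
  assert (HQ : 2 <= Q) by (unfold Q, q; rewrite S_INR; apply le_INR in Hk; simpl in Hk; lra).
  assert (Hl : 1 <= l) by (apply ln_ge_1; lra).
  (* The required number of hits: each contributes [beta / (80 * Q)] to the squared norm of [z], and
     the final estimate becomes an equality for this [H]. *)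
  set (H := 1600 * Q * Q * l / (beta * beta * (1 - eta))).
  assert (HH : 0 < H).
  { unfold H. apply Rdiv_lt_0_compat; repeat apply Rmult_lt_0_compat; lra. }
  (* The first term serves the union bound, the second gives [2 * m + 1 <= V * V] for the grid, and
     the third gives [1 <= ln V]. *)
  exists (3 * exp H + 160 * Q * Q / beta + 3).
  intros n adj phi t P s Hphi Ht Hg Huncl Hd HN Hs HP.
  unfold unclusterable in Huncl. unfold sample_size in Hs.
  replace (k + 1)%nat with q in * by (unfold q; lia).
  fold Q in Hs, Huncl. fold l in Hs.
  set (V := volV n adj) in *.
  assert (HexpH := exp_pos H).
  assert (H160 : 0 < 160 * Q * Q / beta) by (apply Rdiv_lt_0_compat; [repeat apply Rmult_lt_0_compat; lra|lra]).
  assert (HV : 3 <= V) by lra.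
  assert (HlnV : 1 <= ln V) by (apply ln_ge_1; lra).
  assert (Hbe : 0 < beta * (1 - eta) <= 1) by nra.
  assert (Hs1 : 1600 * Q ^ 2 * l * ln V <= beta * (1 - eta) * INR s).
  { destruct Hs as [Hs _]. apply Rmult_le_compat_l with (r := beta * (1 - eta)) in Hs; [|lra].
    eapply Rle_trans; [|exact Hs]. apply Req_le. field. lra. }
  assert (HllnV : 1 <= l * ln V) by nra.
  assert (Hs2 : 1600 * Q * Q * ln V <= beta * (1 - eta) * INR s).
  { eapply Rle_trans; [|exact Hs1]. simpl (Q ^ 2).
    assert (0 <= Q * Q * ln V) by (repeat apply Rmult_le_pos; lra). nra. }
  (* Eigenvalues are indexed from 0, so [mu k] belongs to the spectrum only if [k < s]. *)
  assert (Hks : (k < s)%nat).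
  { apply INR_lt. assert (Q <= INR s).
    { assert (0 <= INR s) by apply pos_INR.
      assert (beta * (1 - eta) * INR s <= 1 * INR s) by (apply Rmult_le_compat_r; lra).
      assert (0 <= Q * Q * (ln V - 1)) by (repeat apply Rmult_le_pos; lra). nra. }
    unfold Q, q in H0. rewrite S_INR in H0. lra. }
  (* At [phi = 1/30] the regularization parameter would divide by 0; but since [t >= 1] the bound is
     then 0, and positivity of the Gram matrix suffices. *)
  destruct (Rle_lt_or_eq_dec phi (1 / 30)) as [Hphi' | ->]; [lra| |].
  2:{ exists (fun _ => true). split.
      - intros a _ _ mu Hmu. replace (1 - 30 * (1 / 30)) with 0 by field.
        rewrite pow_i by lia. rewrite Rmult_0_r. eapply gram_spectrum_nonneg; eauto.
      - change (prob n s P (fun _ => true)) with (lsum (tuples n s) (weight P)).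
        rewrite weight_total by apply HP. lra. }
  destruct Huncl as [C [HC HCvol]].
  assert (HCpos : forall i, (i < q)%nat -> 0 < vol n adj (C i)).
  { intros i Hi. destruct (HCvol i Hi) as [Hv _]. fold V Q in Hv.
    eapply Rlt_le_trans; [|exact Hv]. apply Rdiv_lt_0_compat; [apply Rmult_lt_0_compat; lra|lra]. }
  destruct (regularized_clusters n adj q C t phi Hg Hd) as [G [W [Y HGWY]]]; [lra|lra|exact HC| |].
  { intros i Hi. destruct (HCvol i Hi) as [_ Hc]. specialize (HCpos i Hi).
    unfold conductance in Hc.
    apply Rmult_le_compat_r with (r := vol n adj (C i)) in Hc; [|lra].
    unfold Rdiv in Hc. rewrite Rmult_assoc, Rinv_l in Hc by lra. lra. }
  assert (HFup : forall al, wip n (deg n adj) (cluster_comb q C al) (cluster_comb q C al)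
     <= V * rsum q (fun i => al i * al i)).
  { intros al. rewrite cluster_comb_norm, <- rsum_scal by exact HC. apply rsum_le; intros i Hi.
    assert (H0 := vol_le_volV n adj (C i)). fold V in H0.
    assert (0 <= al i * al i) by apply Rle_0_sqr. nra. }
  assert (HFlow : forall al, beta * V / Q * rsum q (fun i => al i * al i)
     <= wip n (deg n adj) (cluster_comb q C al) (cluster_comb q C al)).
  { intros al. rewrite cluster_comb_norm, <- rsum_scal by exact HC. apply rsum_le; intros i Hi.
    destruct (HCvol i Hi) as [H0 _]. fold V Q in H0.
    assert (0 <= al i * al i) by apply Rle_0_sqr. nra. }
  assert (Hx0 : 0 <= 80 * Q * Q * V / beta).
  { apply Rlt_le, Rdiv_lt_0_compat; [repeat apply Rmult_lt_0_compat; lra|lra]. }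
  (* Since [m >= 1], a lower bound on [m] also bounds [m^2]; the upper bound keeps the grid
     polynomial in [V]. *)
  destruct (nat_above _ Hx0) as [m [Hm1 [Hm2 Hm3]]].
  assert (Hm1' : 1 <= INR m) by (replace 1 with (INR 1) by reflexivity; apply le_INR; auto).
  assert (Hmm : 80 * Q * Q * V <= beta * (INR m * INR m)).
  { replace (80 * Q * Q * V) with (beta * (80 * Q * Q * V / beta)) by (field; lra).
    apply Rmult_le_compat_l; [lra|]. nra. }
  assert (Hm4 : 4 * Q <= INR m * INR m).
  { assert (0 <= INR m * INR m) by apply Rle_0_sqr.
    assert (beta * (INR m * INR m) <= 1 * (INR m * INR m)) by (apply Rmult_le_compat_r; lra).
    assert (0 <= Q * (Q * V - 1)) by (apply Rmult_le_pos; nra). nra. }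
  set (sumsq b := rsum q (fun i => gridpt m b i * gridpt m b i)).
  (* Grid points near 0 are left out, as their thresholds would be too small; those near unit
     vectors remain. *)
  set (L := filter (fun b => if Rle_dec (1 / 4) (sumsq b) then true else false) (tuples (2 * m + 1) q)).
  set (hit b v := if Rle_dec (beta / (5 * INR q) * sumsq b)
                    (comb q G (gridpt m b) v * comb q G (gridpt m b) v) then true else false).
  (* Hits fill a fraction [beta / (2 * Q)] of the volume by [hit_volume]; the distortion of [P]
     costs a factor [1 - eta]. *)
  destruct (few_hits_union_bound (list nat) L n s P hit ((1 - eta) * (beta / (2 * Q))) H)
    as [Good [HGood Hprob]]; [apply HP|apply HP| |].
  { intros b Hb. apply filter_In in Hb. destruct Hb as [_ Hb].
    destruct Rle_dec as [Hb4|]; [|discriminate].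
    apply (approx_deg_dist_mass n adj eta); [exact HP|fold V; lra|lra|].
    destruct (HGWY (gridpt m b)) as [Hf [Hy _]].
    assert (Hvol := hit_volume n adj q beta (sumsq b) _ _ _ ltac:(lia) ltac:(lra) ltac:(lra) Hf).
    eapply Rle_trans; [|eapply Rle_trans; [apply Hvol|]].
    - fold V Q. apply Req_le. field. lra.
    - intros v Hv. rewrite (cluster_comb_sq n) by auto. apply rsum_le; intros i _.
      assert (0 <= gridpt m b i * gridpt m b i) by apply Rle_0_sqr.
      unfold indic. destruct (C i v); lra.
    - apply HFlow.
    - exact Hy.
    - apply Req_le, rsum_ext; intros v _. unfold hit. destruct Rle_dec; reflexivity. }
  exists Good. split.
  2:{ enough (INR (length L) * exp (H - (1 - eta) * (beta / (2 * Q)) * INR s / 2) <= 1 / 3) by lra.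
      apply (union_bound_numerics _ V q); [apply pos_INR|lia|lra|lra| |].
      - apply Rle_trans with (INR (length (tuples (2 * m + 1) q))).
        + apply le_INR. apply filter_length_le.
        + rewrite tuples_length. apply pow_incr. split; [apply pos_INR|].
          rewrite plus_INR, mult_INR. simpl (INR 2); simpl (INR 1).
          replace (80 * Q * Q * V / beta) with (160 * Q * Q / beta * V / 2) in Hm3 by (field; lra).
          nra.
      - fold Q. replace ((1 - eta) * (beta / (2 * Q)) * INR s / 2)
          with (beta * (1 - eta) * INR s * / (4 * Q)) by (field; lra).
        apply Rle_trans with (1600 * Q * Q * ln V * / (4 * Q)).
        + replace (1600 * Q * Q * ln V * / (4 * Q)) with (400 * Q * ln V) by (field; lra). nra.
        + apply Rmult_le_compat_r; [apply Rlt_le, Rinv_0_lt_compat; lra|lra]. }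
  intros a Ha HaG mu Hmu.
  apply in_tuples in Ha. destruct Ha as [Hlen Ha].
  (* The test vectors for Courant-Fischer are the regularized indicators read at the samples. *)
  apply (spectrum_lower_bound s (gram n adj t a) mu k (fun i j => G i (nth j a O)) _ Hmu Hks).
  intros al Hal z. fold q in Hal.
  destruct (grid_near m q al Hm1) as [b [Hb Hnear]].
  { intros i Hi. rewrite <- Hal. apply (rsum_term_le q (fun i => al i * al i)); [|auto].
    intros; apply Rle_0_sqr. }
  destruct (grid_point_norm m q al (gridpt m b) Hm4 ltac:(lia) Hal Hnear) as [Hdist Hnorm].
  assert (HbL : In b L).
  { apply filter_In. split; [auto|]. destruct Rle_dec; [auto|tauto]. }
  assert (Hhits : H * (beta / (80 * Q)) <= lsum a (fun v => comb q G al v * comb q G al v)).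
  { apply (many_hits_everywhere n adj q C G beta m a b al H); auto; try lia; try lra.
    - apply HGWY.
    - fold V; lra.
    - apply HGood; auto. }
  rewrite <- (lsum_rsum_nth a (fun v => comb q G al v * comb q G al v)), Hlen in Hhits.
  change (H * (beta / (80 * Q)) <= rsum s (fun j => z j * z j)) in Hhits.
  destruct (HGWY al) as [_ [_ [_ [HW HWG]]]].
  assert (Hform := gram_form_ge n adj t a s (comb q W al) z Hd
    (fun j Hj => Ha _ (nth_In a O (eq_ind_r (fun x => (j < x)%nat) Hj Hlen)))
    (fun j _ => eq_sym (HWG _))).
  set (Z := rsum s (fun j => z j * z j)) in *.
  set (quad := rsum s (fun r => rsum s (fun j => gram n adj t a r j * z j) * z r)) in *.
  set (ww := wip n (deg n adj) (comb q W al) (comb q W al)) in *.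
  set (p := (1 - 30 * phi) ^ (2 * t)) in *.
  assert (Hp : 0 < p) by (apply pow_lt; lra).
  assert (HZ : 0 < Z).
  { eapply Rlt_le_trans; [|exact Hhits].
    apply Rmult_lt_0_compat; [auto|apply Rdiv_lt_0_compat; lra]. }
  split; [exact HZ|].
  assert (Hww : 2 * p * ww <= 5 * V).
  { specialize (HFup al). rewrite Hal in HFup. lra. }
  assert (Hquad : 0 <= quad).
  { unfold quad. rewrite gram_form. apply rsum_nonneg; intros; apply Rle_0_sqr. }
  (* Combines [Z * Z <= quad * ww] with [2 * p * ww <= 5 * V]; one factor [Z] is then bounded below
     by the hits and the other is kept for the Rayleigh quotient. *)
  assert (H1 : 2 * p * (Z * Z) <= 5 * V * quad).
  { apply Rle_trans with (2 * p * (quad * ww)).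
    - apply Rmult_le_compat_l; lra.
    - nra. }
  assert (H2 : 2 * p * (Z * (H * (beta / (80 * Q)))) <= 5 * V * quad).
  { eapply Rle_trans; [|exact H1]. apply Rmult_le_compat_l; [lra|].
    apply Rmult_le_compat_l; lra. }
  apply Rmult_le_reg_l with (5 * V); [lra|].
  eapply Rle_trans; [|exact H2]. apply Req_le. unfold H. field. lra.
Qed.
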